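(* Let $d\ge1$, $T>0$, $H\in(\frac13,\frac12]$, $\alpha\in(\frac13,H)$, $x_0\in\mathbb{R}^d$, and let $B^H$ be a $d$-dimensional fractional Brownian motion with a fixed lift $\mathbf B^H=(B^H,\mathbb B^H)$ which is an $\alpha$-geometric rough path for each $\omega$ in a set $\Omega'$ of probability one. Assume: (F1) $f:\mathbb{R}^d\to\mathbb{R}^d$ is bounded and continuous; (S1) $\sigma:\mathbb{R}^d\to M_{d\times d}(\mathbb{R})$ is twice continuously differentiable with $\|\sigma\|_\infty+\|D\sigma\|_\infty+\|D^2\sigma\|_\infty<\infty$; (S2) there is $\lambda>0$ such that $|v^{\intercal}\sigma(x)v|\ge\lambda\|v\|^2$ for all $v,x\in\mathbb{R}^d$; (S3) $\sigma^{-1}$ is a conservative vector field, i.e. for every path $\gamma$ in $\mathbb{R}^d$ the path integral $\int_\gamma\sigma(x)^{-1}dx$ depends only on the end points of $\gamma$. Then there exists a diffeomorphism $G:\mathbb{R}^d\to\mathbb{R}^d$ such that $DG(z)=\sigma(z)^{-1}$ for all $z$, and (for every $\omega\in\Omega'$) $(X,\sigma(X))$ is a solution to $$X_t=x_0+\int_0^tf(X_s)\,ds+\int_0^t\sigma(X_s)\,d\mathbf B^H_s,\qquad t\in[0,T],$$ if and only if $Z_t=G(X_t)$ satisfies $$Z_t=G(x_0)+\int_0^t\tilde f(Z_r)\,dr+B^H_t,\qquad t\in[0,T],$$ where $\tilde f:\mathbb{R}^d\to\mathbb{R}^d$, $\tilde f(z)=DG(G^{-1}(z))f(G^{-1}(z))$,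 is a bounded continuous function.
   Context: Fractional Brownian motion with Hurst parameter $H$: the centered $\mathbb{R}^d$-valued Gaussian process with covariance $\frac12(t^{2H}+s^{2H}-|t-s|^{2H})I_d$. Notation: $W_{s,t}:=W_t-W_s$. An $\alpha$-rough path over an $\alpha$-Hölder path $W:[0,T]\to\mathbb{R}^d$ is a pair $\mathbf W=(W,\mathbb W)$, $\mathbb W:[0,T]^2\to\mathbb{R}^d\otimes\mathbb{R}^d$, with $\mathbb W_{s,t}-\mathbb W_{s,u}-\mathbb W_{u,t}=W_{s,u}\otimes W_{u,t}$, $\sup_{s\ne t}|W_{s,t}|/|t-s|^\alpha<\infty$ and $\sup_{s\neq t}|\mathbb W_{s,t}|/|t-s|^{2\alpha}<\infty$. It is geometric if the symmetric part of $\mathbb W_{s,t}$ equals $\frac12W_{s,t}\otimes W_{s,t}$. For $H=\frac12$ the fixed lift is the Stratonovich one, $\mathbb B_{s,t}=\int_s^t(B_r-B_s)\otimes\circ dB_r$. A $W$-controlled rough path is a pair of continuous paths $(Y,Y')$ on $[0,T]$ with values in $\mathbb{R}^m$ and $\mathbb{R}^{m\times d}$, both $\alpha$-Hölder, such that $\sup_{s\neq t}|Y_{s,t}-Y'_sW_{s,t}|/|t-s|^{2\alpha}<\infty$; the space of these is $C^\alpha_W(\mathbb{R}^m)$. For a controlled rough path with values in $(\mathbb{R}^{m\times d},\mathbb{R}^{m\times d\times d})$ the rough integral is $\int_0^TY_r\,d\mathbf W_r:=\lim_{|\mathcal P|\to0}\sum_{[s,t]\in\mathcal P}(Y_sW_{s,t}+Y'_s\mathbb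 W_{s,t})$, where $(Y'_s\mathbb W_{s,t})^i=\sum_{a,k}(Y'_s)^{i,k}_a\mathbb W^{a,k}_{s,t}$, $a$ being the index of the Gubinelli-derivative direction and $k$ the integrator index. Solution: $(X,X')\in C^\alpha_{B^H}(\mathbb{R}^d)$ is a solution of the first equation if it is a fixed point of $\Psi(Y,Y')(t)=\big(x_0+\int_0^tf(Y_r)dr+\int_0^t\sigma(Y_r)d\mathbf B^H_r,\ \sigma(Y_t)\big)$, where the second integral is the rough integral of $(\sigma(Y),D\sigma(Y)Y')$; in particular $X'=\sigma(X)$. The equation for $Z$ is an ordinary (Riemann) integral equation for a continuous path $Z$.
   Formalization: The formal theorem assumes that B^H_0(ω)=0 for every ω in Ω'; the covariance gives this only almost surely, and where B^H_0(ω)≠0 the claimed equivalence fails at t=0. *)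

(* Defs.v *)
From HB Require Import structures.
From mathcomp Require Import all_boot all_order all_algebra.
From mathcomp Require Import all_classical all_reals all_analysis.

Set Implicit Arguments.
Unset Strict Implicit.
Unset Printing Implicit Defensive.

Import Order.TTheory GRing.Theory Num.Theory.
Import numFieldNormedType.Exports.

Local Open Scope classical_set_scope.
Local Open Scope ring_scope.

(* Vectors of R^d are columns. The library norm on matrices is the max norm;
   it is used only where the choice of a norm is immaterial (boundedness,
   Hoelder bounds, limits). A path on [0, T] is a total function of R of which
   only the values on [0, T] are ever constrained. *)

Section smoothness.
Context {R : realType} {V W : normedModType R}.

(* In finite dimension, continuity and differentiability of x |-> 'd f x as an
   operator-valued map are those of x |-> 'd f x v for all v. *)
Definition C1 (f : V -> W) : Prop :=
  (forall x, differentiable f x) /\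
  (forall v, continuous (fun x => 'd f x v)).

Definition C2 (f : V -> W) : Prop :=
  (forall x, differentiable f x) /\
  (forall v, C1 (fun x => 'd f x v)).

Definition C2_bounded (f : V -> W) : Prop :=
  C2 f /\ exists M : R, forall x,
    [/\ `|f x| <= M,
        (forall v, `|'d f x v| <= M * `|v|) &
        (forall v w, `|'d (fun y => 'd f y v) x w| <= M * `|v| * `|w|)].

End smoothness.

Definition diffeomorphism {R : realType} {V W : normedModType R} (G : V -> W)
    (Ginv : W -> V) : Prop :=
  [/\ cancel G Ginv, cancel Ginv G, C1 G & C1 Ginv].

Section path_integrals.
Context {R : realType} {d : nat}.

Definition vec_integral (a b : R) (g : R -> 'cV[R]_d) : 'cV[R]_d :=
  \col_i (\int[lebesgue_measure]_(r in `[a, b]) (g r i 0))%R.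

Inductive piecewise_C1 (gamma : R -> 'cV[R]_d) : R -> R -> Prop :=
| piecewise_C1_smooth a b (dgamma : R -> 'cV[R]_d) : a < b ->
    {within `[a, b], continuous gamma} ->
    {within `[a, b], continuous dgamma} ->
    (forall t : R, a < t < b -> is_derive t 1 gamma (dgamma t)) ->
    piecewise_C1 gamma a b
| piecewise_C1_cat a c b : piecewise_C1 gamma a c ->
    piecewise_C1 gamma c b -> piecewise_C1 gamma a b.

(* The finitely many times at which 'D_1 gamma is not the velocity do not
   contribute to the integral. *)
Definition path_integral (A : 'cV[R]_d -> 'M[R]_d) (gamma : R -> 'cV[R]_d)
    (a b : R) : 'cV[R]_d :=
  vec_integral a b (fun r => A (gamma r) *m 'D_1 gamma r).

Definition conservative (A : 'cV[R]_d -> 'M[R]_d) : Prop :=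
  forall (g1 g2 : R -> 'cV[R]_d) (a1 b1 a2 b2 : R),
    piecewise_C1 g1 a1 b1 -> piecewise_C1 g2 a2 b2 ->
    g1 a1 = g2 a2 -> g1 b1 = g2 b2 ->
    path_integral A g1 a1 b1 = path_integral A g2 a2 b2.

End path_integrals.

Section partitions.
Context {R : realType}.

(* The filter "mesh -> 0" on partitions a < s_0 < ... < s_(n-1) = b, encoded as
   in the library by the list of the points other than a. *)
Definition vanishing_mesh (a b : R) : set_system (seq R) :=
  filter_from [set e : R | 0 < e] (fun e => [set s : seq R |
    itv_partition a b s /\ forall n, (n < size s)%N ->
      nth b (a :: s) n.+1 - nth b (a :: s) n < e]).

Definition partition_sum {V : nmodType} (a b : R) (F : R -> R -> V)
    (s : seq R) : V :=
  \sum_(0 <= n < size s) F (nth b (a :: s) n) (nth b (a :: s) n.+1).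

End partitions.

Section rough_paths.
Context {R : realType}.

Definition holder_bound {V : normedModType R} (T beta : R) (A : R -> R -> V) :
    Prop :=
  exists C : R, forall s t : R, 0 <= s <= T -> 0 <= t <= T -> s != t ->
    `|A s t| / `|t - s| `^ beta <= C.

Definition increment {V : zmodType} (Y : R -> V) (s t : R) : V := Y t - Y s.

Definition is_rough_path (d : nat) (T alpha : R) (W : R -> 'cV[R]_d)
    (WW : R -> R -> 'M[R]_d) : Prop :=
  [/\ forall s u t : R, 0 <= s <= T -> 0 <= u <= T -> 0 <= t <= T ->
        WW s t - WW s u - WW u t = increment W s u *m (increment W u t)^T,
      holder_bound T alpha (increment W) &
      holder_bound T (2 * alpha) WW].

Definition is_geometric_rough_path (d : nat) (T alpha : R) (W : R -> 'cV[R]_d)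
    (WW : R -> R -> 'M[R]_d) : Prop :=
  is_rough_path T alpha W WW /\
  forall s t : R, 0 <= s <= T -> 0 <= t <= T ->
    2^-1 *: (WW s t + (WW s t)^T) =
    2^-1 *: (increment W s t *m (increment W s t)^T).

Definition controlled (m d : nat) (T alpha : R) (W : R -> 'cV[R]_d)
    (Y : R -> 'cV[R]_m) (Y' : R -> 'M[R]_(m, d)) : Prop :=
  [/\ {within `[0, T], continuous Y}, {within `[0, T], continuous Y'},
      holder_bound T alpha (increment Y), holder_bound T alpha (increment Y') &
      holder_bound T (2 * alpha)
        (fun s t => increment Y s t - Y' s *m increment W s t)].

(* The Gubinelli derivative of an m x d matrix-valued path is given by its
   values Y' s a in the coordinate directions a. *)
Definition rough_contract (m d : nat) (Y' : 'I_d -> 'M[R]_(m, d)) (A : 'M[R]_d) :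
    'cV[R]_m :=
  \col_i \sum_(a < d) \sum_(k < d) Y' a i k * A a k.

Definition is_rough_integral (m d : nat) (W : R -> 'cV[R]_d)
    (WW : R -> R -> 'M[R]_d) (Y : R -> 'M[R]_(m, d))
    (Y' : R -> 'I_d -> 'M[R]_(m, d)) (a b : R) (I : 'cV[R]_m) : Prop :=
  partition_sum a b
    (fun s t => Y s *m increment W s t + rough_contract (Y' s) (WW s t))
    @ vanishing_mesh a b --> I.

(* (X, X') is a fixed point of Psi; the rough integrand is
   (sigma(X), D sigma(X) X'). *)
Definition is_rde_solution (d : nat) (T alpha : R) (W : R -> 'cV[R]_d)
    (WW : R -> R -> 'M[R]_d) (f : 'cV[R]_d -> 'cV[R]_d)
    (sigma : 'cV[R]_d -> 'M[R]_d) (x0 : 'cV[R]_d)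
    (X : R -> 'cV[R]_d) (X' : R -> 'M[R]_d) : Prop :=
  controlled T alpha W X X' /\
  forall t : R, 0 <= t <= T ->
    X' t = sigma (X t) /\
    exists2 I : 'cV[R]_d,
      is_rough_integral W WW (fun s => sigma (X s))
        (fun s a => 'd sigma (X s) (col a (X' s))) 0 t I &
      X t = x0 + vec_integral 0 t (fun r => f (X r)) + I.

Definition is_additive_solution (d : nat) (T : R) (W : R -> 'cV[R]_d)
    (g : 'cV[R]_d -> 'cV[R]_d) (z0 : 'cV[R]_d) (Z : R -> 'cV[R]_d) : Prop :=
  {within `[0, T], continuous Z} /\
  forall t : R, 0 <= t <= T ->
    Z t = z0 + vec_integral 0 t (fun r => g (Z r)) + W t.

End rough_paths.

Section fractional_brownian_motion.
Context {disp : measure_display} {Omega : measurableType disp} {R : realType}.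
Variable P : probability Omega R.

(* The library's normal_prob m 0 is not a Dirac mass, hence the case split. *)
Definition is_gaussian (X : Omega -> R) : Prop :=
  exists m s : R, 0 <= s /\ forall A : set R, measurable A ->
    P (X @^-1` A) = (if s == 0 then \d_m A else normal_prob m s A).

Definition is_fbm (d : nat) (T H : R) (B : R -> 'I_d -> {RV P >-> R}) : Prop :=
  [/\ forall (n : nat) (t : 'I_n -> R) (j : 'I_n -> 'I_d) (c : 'I_n -> R),
        (forall k, 0 <= t k <= T) ->
        is_gaussian (fun w => \sum_(k < n) c k * B (t k) (j k) w),
      forall (t : R) (i : 'I_d), 0 <= t <= T -> ('E_P[B t i] = 0)%E &
      forall (s t : R) (i j : 'I_d), 0 <= s <= T -> 0 <= t <= T ->
        covariance P (B s i) (B t j) =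
        (if i == j then
           2^-1 * (t `^ (2 * H) + s `^ (2 * H) - `|t - s| `^ (2 * H))
         else 0)%:E].

Definition sample_path (d : nat) (B : R -> 'I_d -> {RV P >-> R}) (w : Omega) :
    R -> 'cV[R]_d :=
  fun t => \col_i B t i w.

Definition sample_lift (d : nat) (BB : R -> R -> 'I_d -> 'I_d -> {RV P >-> R})
    (w : Omega) : R -> R -> 'M[R]_d :=
  fun s t => \matrix_(i, k) BB s t i k w.

(* BB_{s,t} is the Stratonovich integral of B - B_s against B: the limit in
   probability of the trapezoidal sums. *)
Definition is_stratonovich_lift (d : nat) (T : R)
    (B : R -> 'I_d -> {RV P >-> R})
    (BB : R -> R -> 'I_d -> 'I_d -> {RV P >-> R}) : Prop :=
  forall (s t : R) (i k : 'I_d) (e : R), 0 <= s -> s <= t -> t <= T -> 0 < e ->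
    (fun p : seq R => P [set w | e <=
       `|partition_sum s t (fun u v =>
           2^-1 * ((B u i w - B s i w) + (B v i w - B s i w)) *
           (B v k w - B u k w)) p - BB s t i k w|])
    @ vanishing_mesh s t --> 0%E.

End fractional_brownian_motion.

(* Main.v *)
(* The potential G of sigma^-1 is its integral along segments from 0; since
   the quadratic form of sigma^-1 is bounded away from 0 on unit vectors, G is
   bi-Lipschitz, and it is onto because a minimiser of |G - y|^2 must be a zero:
   the vector - sigma (G - y) is a descent direction. The inverse F solves
   DF = sigma o F, so its second-order Taylor expansion at Z_s in the direction
   W_{s,t} is sigma(X_s) W_{s,t} + (1/2) (Dsigma sigma)(X_s)(W_{s,t}, W_{s,t})
   with X = F(Z); by geometricity and symmetry of D^2 F this is the germ of the
   rough integral, up to |t - s|^(3 alpha). If Z solves the additive equation,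
   telescoping this expansion shows that the compensated Riemann sums converge
   to the right limit. Conversely, if X solves the rough equation, the sewing
   bound turns the convergence of the Riemann sums into a local expansion of X,
   which says that Z - W - int ftilde(Z) has increments of order
   |t - s|^(3 alpha), hence is constant as 3 alpha > 1. *)
Require Import Defs.
From HB Require Import structures.
From mathcomp Require Import all_boot all_order all_algebra.
From mathcomp Require Import all_classical all_reals all_analysis.
From mathcomp Require Import ring lra.

Set Implicit Arguments.
Unset Strict Implicit.
Unset Printing Implicit Defensive.

Import Order.TTheory GRing.Theory Num.Theory.
Import numFieldNormedType.Exports.

Local Open Scope classical_set_scope.
Local Open Scope ring_scope.

(** All estimates live on one scale h = (t - s)^alpha. Increments of W and Z have size h; as 2 alpha
    <= 1, a time increment, hence the increment of the drift, has size h^2. Errors of size h^3 are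
    harmless because 3 alpha > 1. Since sigma is only C^2, no third derivative of F is written down:
    Lipschitz bounds on Dsigma control the Taylor remainders, and the symmetry of D^2 F is extracted
    from finite differences. Both implications rest on one expansion, that of F at Z_s + W_{s,t} +
    (drift increment). For an additive solution this point is Z_t itself; for a rough solution it is
    the point with which Z_t has to be compared. The rough integral is never constructed by sewing.
    In one direction its existence is part of the notion of solution, in the other the limit is
    exhibited. Sewing only measures the distance from the integral to its germ, and it needs an
    almost additive germ: this comes from the controlledness of X, which G turns into Z_{s,t} -
    W_{s,t} = O(h^2). *)

Section matrix_norm.
Context {R : realType}.

Lemma ler_mx_coord m n (A : 'M[R]_(m, n)) i j : `|A i j| <= `|A|.
Proof.
rewrite [leRHS]/Num.Def.normr/= mx_normrE.
exact: (le_bigmax _ (fun ij => `|A ij.1 ij.2|) (i, j)).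
Qed.

Lemma mx_norm_le m n (A : 'M[R]_(m, n)) (c : R) : 0 <= c ->
  (forall i j, `|A i j| <= c) -> `|A| <= c.
Proof.
move=> c0 Ac; rewrite [leLHS]/Num.Def.normr/= mx_normrE.
by apply: bigmax_le => // -[i j] _; exact: Ac.
Qed.

(** The max norm is not submultiplicative: an entry of the product is a sum of [n] terms. The
    factors [d%:R] of the later constants come from here. *)
Lemma ler_norm_mulmx m n p (A : 'M[R]_(m, n)) (B : 'M[R]_(n, p)) :
  `|A *m B| <= n%:R * `|A| * `|B|.
Proof.
apply: mx_norm_le => [|i j]; first by rewrite !mulr_ge0.
rewrite mxE (le_trans (ler_norm_sum _ _ _))//.
have -> : n%:R * `|A| * `|B| = \sum_(k < n) `|A| * `|B|.
  by rewrite sumr_const card_ord -mulrA mulr_natl.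
by apply: ler_sum => k _; rewrite normrM ler_pM// ler_mx_coord.
Qed.

Lemma normr_trmx m n (A : 'M[R]_(m, n)) : `|A^T| = `|A|.
Proof.
apply/eqP; rewrite eq_le; apply/andP; split; apply: mx_norm_le => // i j.
  by rewrite mxE ler_mx_coord.
by have := ler_mx_coord A^T j i; rewrite mxE.
Qed.

End matrix_norm.

(** * Mean value inequality, Taylor bounds and differentiability *)

Section calculus.
Context {R : realType}.

Lemma near_norm_le (V : normedModType R) (x : V) (e : R) : 0 < e ->
  \forall y \near x, `|x - y| <= e.
Proof.
move=> e0; have := nbhsx_ballx x e e0.
by rewrite -ball_normE; apply: filterS => y /ltW.
Qed.

Lemma lipschitz_continuous (V W : normedModType R) (g : V -> W) (K : R) :
  (forall x y, `|g x - g y| <= K * `|x - y|) -> continuous g.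
Proof.
move=> gK x; have K1 : 0 < `|K| + 1 by rewrite ltr_wpDl.
apply/cvgrPdist_le => e e0; near=> y.
apply: (le_trans (gK x y)).
rewrite (@le_trans _ _ ((`|K| + 1) * `|x - y|))//.
  by rewrite ler_wpM2r// ler_wpDr// ler_norm.
rewrite -ler_pdivlMl// mulrC; near: y.
by apply: near_norm_le; rewrite divr_gt0.
Unshelve. all: by end_near. Qed.

Lemma mulmx_continuous m n p (A : 'M[R]_(m, n)) :
  continuous (mulmx A : 'M[R]_(n, p) -> 'M[R]_(m, p)).
Proof.
apply: (@lipschitz_continuous _ _ _ (n%:R * `|A|)) => x y.
by rewrite -mulmxBr ler_norm_mulmx.
Qed.

Lemma is_derive_mx m n (h : R -> 'M[R]_(m, n)) (t : R) dh i j :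
  is_derive t 1 h dh -> is_derive t 1 (fun s => h s i j) (dh i j).
Proof.
move=> [hd <-]; apply: DeriveDef; first by have /derivable_mxP := hd; exact.
by rewrite derive_mx// mxE.
Qed.

Lemma is_derive_line (V W : normedModType R) (f df : V -> W) (p w : V) (t : R) :
  is_diff (p + t *: w) f df ->
  is_derive t 1 (fun s => f (p + s *: w)) (df w).
Proof.
move=> fd.
have dl : is_diff t (fun s : R => p + s *: w) (fun s => 0 + s *: w).
  exact: (@is_diffD _ _ _ (cst p) (fun s : R => s *: w) 0 (fun s => s *: w)).
have dg := is_diff_comp dl fd.
apply: DeriveDef; first exact/diff_derivable/ex_diff.
by rewrite deriveE ?diff_val/= ?add0r ?scale1r//; exact: ex_diff.
Qed.

Lemma is_derive_scalel (V : normedModType R) (k : R -> R) (dk t : R) (v : V) :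
  is_derive t 1 k dk -> is_derive t 1 (fun s => k s *: v) (dk *: v).
Proof.
move=> kd; have qd : is_diff t k ('d k t).
  by apply: differentiableP; apply/derivable1_diffP; case: kd.
have sd := is_diff_comp qd (is_diff_scalel (k t) v).
apply: DeriveDef; first exact/diff_derivable/ex_diff.
rewrite deriveE ?diff_val/=; last exact: ex_diff.
by rewrite -deriveE ?derive_val//; exact: ex_diff.
Qed.

(** For vector-valued maps only the inequality survives. In the max norm it follows entry by entry,
    with an intermediate time that depends on the entry. *)
Lemma mx_mean_value m n (h dh : R -> 'M[R]_(m, n)) (K : R) :
  (forall t : R, is_derive t 1 h (dh t)) ->
  (forall t, 0 <= t <= 1 -> `|dh t| <= K) -> `|h 1 - h 0| <= K.
Proof.
move=> hd hK; have K0 : 0 <= K by rewrite (le_trans _ (hK 0 _))// lexx ler01.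
apply: mx_norm_le => // i j; rewrite !mxE.
have hc : {within `[0, 1], continuous (fun s => h s i j)}.
  apply: continuous_subspaceT => t; apply: differentiable_continuous.
  by apply/derivable1_diffP; have [] := is_derive_mx i j (hd t).
have [c] := MVT ltr01 (fun t _ => is_derive_mx i j (hd t)) hc.
rewrite in_itv/= => /andP[c0 c1] ->; rewrite subr0 mulr1.
by rewrite (le_trans (ler_mx_coord _ _ _))// hK// !ltW.
Qed.

Section diff.
Context {V : normedModType R} {m n : nat}.
Context {f : V -> 'M[R]_(m, n)} {df : V -> V -> 'M[R]_(m, n)}.
Hypothesis fd : forall x, is_diff x f (df x).

Lemma diff_bounded_lipschitz (K : R) :
  (forall x v, `|df x v| <= K * `|v|) ->
  forall x y, `|f x - f y| <= K * `|x - y|.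
Proof.
move=> fK x y.
have := @mx_mean_value _ _ (fun s => f (y + s *: (x - y))) _ (K * `|x - y|)
  (fun t => is_derive_line (fd _)) (fun t _ => fK _ _).
by rewrite scale1r scale0r addr0 subrKC.
Qed.

(** Once the linear part is subtracted along the segment, the derivative
    [df (x + s *: w) w - df x w] is already of size |w|^2, so a Lipschitz differential does the work
    of a second derivative. *)
Lemma taylor1 (K : R) : 0 <= K ->
  (forall x y v, `|df x v - df y v| <= K * `|x - y| * `|v|) ->
  forall x w, `|f (x + w) - f x - df x w| <= K * `|w| ^+ 2.
Proof.
move=> K0 fK x w.
have := @mx_mean_value _ _ (fun s => f (x + s *: w) - s *: df x w)
  (fun s => df (x + s *: w) w - df x w) (K * `|w| ^+ 2).
rewrite !scale1r !scale0r addr0 subr0 addrAC; apply.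
- move=> t; have d1 := is_derive_line (w := w) (fd (x + t *: w)).
  have d2 := is_derive_scalel (df x w) (is_derive_id t 1).
  by rewrite scale1r in d2; exact: is_deriveB.
- move=> t /andP[t0 t1]; rewrite (le_trans (fK _ _ _))//.
  rewrite [x + _]addrC addrK normrZ (ger0_norm t0) expr2 [leRHS]mulrA ler_wpM2r//.
  by rewrite ler_wpM2l// ler_piMl.
Qed.

End diff.

(** Serves both for the potential and for its inverse: the differential is guessed and then
    confirmed by a quadratic remainder. *)
Lemma is_diff_quadratic (V W : normedModType R) (f : V -> W) (x : V)
    (L : {linear V -> W}) (K : R) : continuous L ->
  (forall w, `|f (x + w) - f x - L w| <= K * `|w| ^+ 2) -> is_diff x f L.
Proof.
move=> Lc fK.
have fo : f \o shift x = cst (f x) + L +o_ 0 id.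
  apply/eqaddoP => e e0; near=> w.
  rewrite /= !fctE opprD addrA [w + x]addrC.
  apply: (le_trans (fK w)); rewrite expr2 mulrA ler_wpM2r//.
  (* The sign of [K] is unknown; [|K| + 1] is positive and can be divided by. *)
  rewrite (@le_trans _ _ ((`|K| + 1) * `|w|))//.
    by rewrite ler_wpM2r// ler_wpDr// ler_norm.
  have K1 : 0 < `|K| + 1 by rewrite ltr_wpDl.
  rewrite -ler_pdivlMl// mulrC; near: w.
  have eK : 0 < e / (`|K| + 1) by rewrite divr_gt0.
  by apply: filterS (near_norm_le 0 eK) => w; rewrite sub0r normrN.
have dL := diff_unique Lc fo.
by apply: DiffDef => //; apply/diff_locallyP; rewrite dL.
Unshelve. all: by end_near. Qed.

End calculus.

(** * Partitions, vanishing mesh and Riemann sums *)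

Section partition.
Context {R : realType}.
Implicit Types (a b c e : R) (s t : seq R).

Section partition_sum.
Context {V : nmodType}.
Implicit Type F : R -> R -> V.

Lemma partition_sum_nil a b F : partition_sum a b F [::] = 0.
Proof. by rewrite /partition_sum big_geq. Qed.

Lemma partition_sum_cons a b F x s :
  partition_sum a b F (x :: s) = F a x + partition_sum x b F s.
Proof. by rewrite /partition_sum/= big_nat_recl. Qed.

Lemma partition_sum_cat a b c F s t : itv_partition a b s ->
  partition_sum a c F (s ++ t) = partition_sum a b F s + partition_sum b c F t.
Proof.
elim: s a => [a /itv_partition_nil <-|x s ih a asb].
  by rewrite partition_sum_nil add0r.
by rewrite cat_cons !partition_sum_cons (ih x) ?addrA//;
  exact: itv_partition_cons asb.
Qed.

End partition_sum.

Lemma partition_sum_increment (V : zmodType) a b (J : R -> V) s :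
  itv_partition a b s -> partition_sum a b (increment J) s = J b - J a.
Proof.
elim: s a => [a /itv_partition_nil <-|x s ih a asb].
  by rewrite partition_sum_nil subrr.
rewrite partition_sum_cons (ih x) /increment; last exact: itv_partition_cons asb.
by rewrite addrC subrKA.
Qed.

Lemma partition_sumB (V : zmodType) a b (F G : R -> R -> V) s :
  partition_sum a b (fun u v => F u v - G u v) s =
  partition_sum a b F s - partition_sum a b G s.
Proof. by rewrite /partition_sum big_split/= sumrN. Qed.

Lemma eq_partition_sum (V : nmodType) a b (F G : R -> R -> V) s :
  itv_partition a b s ->
  (forall u v, a <= u -> u <= v -> v <= b -> F u v = G u v) ->
  partition_sum a b F s = partition_sum a b G s.
Proof.
elim: s a => [a _ _|x s ih a asb FG]; first by rewrite !partition_sum_nil.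
have xsb := itv_partition_cons asb.
have [/=/andP[/ltW ax _] _] := asb; have xb := itv_partition_le xsb.
rewrite !partition_sum_cons FG// ih// => u v xu; apply: FG.
exact: le_trans xu.
Qed.

(** The mesh condition inside [vanishing_mesh], isolated so that it can be split along [cons] and
    [cat]. *)
Definition mesh_lt a b s e := forall n, (n < size s)%N ->
  nth b (a :: s) n.+1 - nth b (a :: s) n < e.

Lemma mesh_lt_cons a b x s e : mesh_lt a b (x :: s) e <->
  x - a < e /\ mesh_lt x b s e.
Proof.
split=> [H|[xa H] [|n]//]; last by rewrite ltnS => /H.
by split=> [|n ns]; [exact: (H 0%N)|exact: (H n.+1)].
Qed.

Lemma mesh_lt_cat a b c s t e : itv_partition a b s ->
  mesh_lt a b s e -> mesh_lt b c t e -> mesh_lt a c (s ++ t) e.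
Proof.
elim: s a => [a /itv_partition_nil <-//|x s ih a asb].
move=> /mesh_lt_cons[xa sm] tm; apply/mesh_lt_cons; split => //.
by apply: ih => //; exact: itv_partition_cons asb.
Qed.

Lemma exists_mesh_lt a b e : a <= b -> 0 < e ->
  exists s, itv_partition a b s /\ mesh_lt a b s e.
Proof.
move=> + e0; have [n] : exists n, b - a <= n%:R * (e / 2).
  exists (Num.bound `|(b - a) / (e / 2)|).
  rewrite -ler_pdivrMr ?divr_gt0//.
  by rewrite (le_trans (ler_norm _))//; exact: ltW (archi_boundP (normr_ge0 _)).
elim: n a => [a|n ih a].
  rewrite mul0r subr_le0 => ba ab.
  have -> : a = b by apply/eqP; rewrite eq_le ab.
  by exists [::].
rewrite mulrSr mulrDl mul1r => bae; rewrite le_eqVlt => /predU1P[->|ab].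
  by exists [::].
(* Steps of length e / 2 keep the mesh strictly below e. The points must increase strictly and end
   at [b], so a short remainder is covered by a single cell. *)
have [small|large] := leP (b - a) (e / 2).
  exists [:: b]; split; first exact: itv_partition1.
  by apply/mesh_lt_cons; split=> //; rewrite (le_lt_trans small)//; lra.
have [||s [[ps ls] sm]] := ih (a + e / 2); [lra|lra|].
exists (a + e / 2 :: s); split; first by split=> //=; rewrite ps andbT; lra.
by apply/mesh_lt_cons; split=> //; lra.
Qed.

Lemma vanishing_mesh_near a b e (P : set (seq R)) : 0 < e ->
  (forall s, itv_partition a b s -> mesh_lt a b s e -> P s) ->
  \forall s \near vanishing_mesh a b, P s.
Proof. by move=> e0 H; exists e => // s [sp sm]; exact: H. Qed.

#[global] Instance vanishing_mesh_filter a b : Filter (vanishing_mesh a b).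
Proof.
apply: filter_from_filter; first by exists 1 => /=.
move=> e f /= e0 f0; exists (Num.min e f); first by rewrite /= lt_min e0.
by move=> s [sp sm]; split; split => // n /sm; rewrite lt_min => /andP[].
Qed.

(** Properness is what makes limits along this filter unique. *)
Lemma vanishing_mesh_proper a b : a <= b -> ProperFilter (vanishing_mesh a b).
Proof.
move=> ab; apply: filter_from_proper => e /= e0.
by have [s] := exists_mesh_lt ab e0; exists s.
Qed.

Lemma eq_cvg_partition_sum (V : normedModType R) a b (F G : R -> R -> V) (l : V) :
  (forall u v, a <= u -> u <= v -> v <= b -> F u v = G u v) ->
  partition_sum a b F @ vanishing_mesh a b --> l ->
  partition_sum a b G @ vanishing_mesh a b --> l.
Proof.
move=> FG; apply: cvg_trans; apply: near_eq_cvg.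
apply: (vanishing_mesh_near ltr01) => s sp _.
exact: (eq_partition_sum sp FG).
Qed.

Lemma partition_sum_le (V : normedModType R) a b e (D : R -> R -> V) (K : R) s :
  itv_partition a b s -> mesh_lt a b s e ->
  (forall u v, a <= u -> u < v -> v <= b -> v - u < e ->
    `|D u v| <= K * (v - u)) ->
  `|partition_sum a b D s| <= K * (b - a).
Proof.
elim: s a => [a /itv_partition_nil <- _ _|x s ih a asb].
  by rewrite partition_sum_nil normr0 subrr mulr0.
have xsb := itv_partition_cons asb.
have [/=/andP[ax _] _] := asb; have xb := itv_partition_le xsb.
move=> /mesh_lt_cons[xa sm] DK; rewrite partition_sum_cons.
rewrite (le_trans (ler_normD _ _))//.
have -> : K * (b - a) = K * (x - a) + K * (b - x) by ring.
rewrite lerD ?DK// ih// => u v xu uv vb vue.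
by rewrite DK// (le_trans (ltW ax)).
Qed.

(** On a mesh below e, a cell contributes an error at most C e^(theta - 1) (v - u), and the lengths
    add up to b - a; meanwhile the increments of [J] telescope. With [Xi] equal to 0 this says that
    [J] takes the same value at [a] and [b]. *)
Lemma cvg_partition_sum (V : normedModType R) a b (J : R -> V)
    (Xi : R -> R -> V) (C theta : R) :
  a <= b -> 1 < theta ->
  (forall u v, a <= u -> u < v -> v <= b ->
    `|J v - J u - Xi u v| <= C * (v - u) `^ theta) ->
  partition_sum a b Xi @ vanishing_mesh a b --> J b - J a.
Proof.
move=> ab th1 JXi.
have [C0|C0] := ltP C 0; last first.
  apply/cvgrPdist_le => eps eps0.
  have D0 : 0 < C * (b - a) + 1 by rewrite ltr_wpDl// mulr_ge0// subr_ge0.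
  (* Solves (C (b - a) + 1) e^(theta - 1) = eps; the [+ 1] avoids a division by 0. *)
  pose e := (eps / (C * (b - a) + 1)) `^ (theta - 1)^-1.
  have e0 : 0 < e by rewrite powR_gt0// divr_gt0.
  apply: (vanishing_mesh_near e0) => s sp sm.
  rewrite -(partition_sum_increment _ sp) -partition_sumB.
  rewrite (le_trans (@partition_sum_le _ a b e _ (C * (e `^ (theta - 1))) _ sp sm _))//.
    move=> u v au uv vb vue; have vu0 : 0 < v - u by rewrite subr_gt0.
    rewrite (le_trans (JXi _ _ au uv vb))// -mulrA ler_wpM2l//.
    have -> : theta = (theta - 1) + 1 by ring.
    rewrite powRD; last by rewrite (gt_eqF vu0) implybT.
    rewrite powRr1 ?(ltW vu0)// ler_wpM2r ?(ltW vu0)//.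
    have -> : theta - 1 + 1 - 1 = theta - 1 by ring.
    by rewrite ge0_ler_powR ?nnegrE ?subr_ge0 ?(ltW th1) ?(ltW uv) ?(ltW vue) ?(ltW e0).
  have th0 : theta - 1 != 0 by rewrite subr_eq0 gt_eqF.
  rewrite -powRrM mulVf// powRr1 ?divr_ge0 ?(ltW eps0) ?(ltW D0)//.
  rewrite mulrAC mulrA ler_pdivrMr// mulrC ler_pM2l//.
  by rewrite lerDl.
(* A negative [C] contradicts the hypothesis on any nondegenerate interval. *)
have ab0 : a = b.
  apply/eqP; rewrite eq_le ab/= leNgt; apply/negP => lab.
  have := JXi _ _ (lexx a) lab (lexx b); apply/negP; rewrite -ltNge.
  by rewrite (lt_le_trans _ (normr_ge0 _))// pmulr_llt0// powR_gt0// subr_gt0.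
apply/cvgrPdist_le => eps eps0; apply: (vanishing_mesh_near ltr01) => s.
rewrite -ab0 => /itv_partitionxx -> _.
by rewrite partition_sum_nil subrr subr0 normr0 ltW.
Qed.

End partition.

(** * The sewing bound *)

Section sewing.
Context {R : realType}.
Implicit Types (a b s t x : R) (p : seq R).

(* Both sides of the cell straddling the midpoint are at most half as long,
   so the errors of the recursive sewing bound sum geometrically. *)
Lemma partition_split_at s t (m : R) p : itv_partition s t p -> s <= m -> m <= t ->
  s < t -> exists p1 x p2, [/\ p = p1 ++ x :: p2,
    last s p1 <= m <= x, last s p1 < x,
    itv_partition s (last s p1) p1 & itv_partition x t p2].
Proof.
elim: p s => [s /itv_partition_nil -> _ _|y p ih s]; first by rewrite ltxx.
move=> spt sm mt st; have ypt := itv_partition_cons spt.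
have [/=/andP[sy _] _] := spt.
have [my|ym] := leP m y; first by exists [::], y, p; rewrite /= sm my.
have yt : y < t by exact: lt_le_trans mt.
have [p1 [x [p2 [-> lmx lx [P1 l1] P2]]]] := ih _ ypt (ltW ym) mt yt.
by exists (y :: p1), x, p2; split => //; split => //=; rewrite sy.
Qed.

(** Induction on the number of points: cutting [s, t] at the two ends y and x of the straddling cell
    costs two defects of additivity, and each remaining piece has length at most (t - s) / 2. The
    bound is uniform in the partition, so it survives the limit of vanishing mesh. *)
Lemma partition_sum_sewing m n a b (Xi : R -> R -> 'M[R]_(m, n))
    (C theta : R) : 1 < theta -> 0 <= C ->
  (forall s u t, a <= s -> s <= u -> u <= t -> t <= b ->
    `|Xi s t - Xi s u - Xi u t| <= C * (t - s) `^ theta) ->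
  exists K, forall s t p, a <= s -> t <= b -> itv_partition s t p ->
    `|partition_sum s t Xi p - Xi s t| <= K * (t - s) `^ theta.
Proof.
move=> th1 C0 XiC; set q : R := 2 `^ (1 - theta).
have th0 : 0 < theta by rewrite (lt_trans _ th1).
have q1 : q < 1.
  rewrite /q -opprB powRN invf_lt1 ?powR_gt0//.
  have : 1 `^ (theta - 1) < 2 `^ (theta - 1) :> R.
    by apply: gt0_ltr_powR; rewrite ?nnegrE ?subr_gt0// ltr1n.
  by rewrite powR1.
(* [K] is the fixed point of K = K q + 2 C: the two halves together cost K q (t - s)^theta, the two
   defects 2 C (t - s)^theta. It exists because theta > 1 gives q < 1. *)
exists (2 * C / (1 - q)); set K := _ / _.
have q10 : 0 < 1 - q by rewrite subr_gt0.
have K0 : 0 <= K by rewrite divr_ge0 ?mulr_ge0// ltW.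
have KE : K * q + 2 * C = K by rewrite /K; field; rewrite gt_eqF.
clearbody K.
move=> s t p; have [l] := ubnP (size p); elim: l s t p => // l ih s t p.
rewrite ltnS => pn as_ tb spt.
have := itv_partition_le spt; rewrite le_eqVlt => /predU1P[st|st].
  (* The partition is empty, and the defect bound at three equal times forces [Xi s s] to vanish. *)
  move: spt; rewrite st => /itv_partitionxx ->.
  rewrite partition_sum_nil subrr powR0 ?gt_eqF// mulr0 sub0r normrN.
  have := XiC s s s as_ (lexx _) (lexx _).
  rewrite st => /(_ tb); rewrite !subrr powR0 ?gt_eqF// mulr0 sub0r normrN.
  by [].
set mid := (s + t) / 2.
have sm : s <= mid by rewrite /mid; lra.
have mt : mid <= t by rewrite /mid; lra.
have [p1 [x [p2 [pE]]]] := partition_split_at spt sm mt st.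
set y := last s p1 => /andP[ym mx] yx P1 P2.
have sy := itv_partition_le P1; have xt := itv_partition_le P2.
move: pn; rewrite pE size_cat/= addnS => pn.
have n1 : (size p1 < l)%N by rewrite (leq_trans _ pn)// ltnS leq_addr.
have n2 : (size p2 < l)%N by rewrite (leq_trans _ pn)// ltnS leq_addl.
rewrite (partition_sum_cat _ _ _ P1) partition_sum_cons.
have yb : y <= b by rewrite (le_trans (ltW yx))// (le_trans xt).
have ax : a <= x by rewrite (le_trans _ (ltW yx))// (le_trans as_).
have yt : y <= t by rewrite (le_trans (ltW yx)).
have H1 := ih _ _ _ n1 as_ yb P1.
have H2 := ih _ _ _ n2 ax tb P2.
have D1 : `|Xi s t - Xi s y - Xi y t| <= C * (t - s) `^ theta.
  exact: XiC as_ sy yt tb.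
have D2 : `|Xi y t - Xi y x - Xi x t| <= C * (t - s) `^ theta.
  rewrite (le_trans (XiC _ _ _ (le_trans as_ sy) (ltW yx) xt tb))//.
  rewrite ler_wpM2l// ge0_ler_powR ?nnegrE ?(ltW th0) ?subr_ge0 ?(ltW st)//.
  by rewrite lerD2l lerN2.
have half z w : 0 <= w - z -> w - z <= (t - s) / 2 ->
    K * (w - z) `^ theta <= K * q * (t - s) `^ theta / 2.
  move=> zw0 zw; rewrite -!mulrA ler_wpM2l//.
  apply: (@le_trans _ _ (((t - s) / 2) `^ theta)).
    apply: ge0_ler_powR; rewrite ?nnegrE ?(ltW th0) ?divr_ge0 ?subr_ge0 ?(ltW st)//.
    by rewrite -subr_ge0.
  rewrite powRM ?subr_ge0 ?(ltW st)// mulrCA ler_wpM2l ?powR_ge0//.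
  rewrite /q powRB; last by rewrite pnatr_eq0 implybT.
  rewrite powRr1// mulrAC divff// mul1r.
  by rewrite -powR_inv1// -powRrM mulN1r powRN.
have h1 : K * (y - s) `^ theta <= K * q * (t - s) `^ theta / 2.
  by apply: half; rewrite ?subr_ge0//; move: ym; rewrite /mid; lra.
have h2 : K * (t - x) `^ theta <= K * q * (t - s) `^ theta / 2.
  by apply: half; rewrite ?subr_ge0//; move: mx; rewrite /mid; lra.
have -> : partition_sum s y Xi p1 + (Xi y x + partition_sum x t Xi p2) - Xi s t
    = (partition_sum s y Xi p1 - Xi s y) + (partition_sum x t Xi p2 - Xi x t)
      - (Xi s t - Xi s y - Xi y t) - (Xi y t - Xi y x - Xi x t).
  by apply/matrixP => i j; rewrite !mxE; ring.
rewrite -KE.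
have := ler_normB (partition_sum s y Xi p1 - Xi s y
  + (partition_sum x t Xi p2 - Xi x t) - (Xi s t - Xi s y - Xi y t))
  (Xi y t - Xi y x - Xi x t).
have := ler_normB (partition_sum s y Xi p1 - Xi s y
  + (partition_sum x t Xi p2 - Xi x t)) (Xi s t - Xi s y - Xi y t).
have := ler_normD (partition_sum s y Xi p1 - Xi s y)
  (partition_sum x t Xi p2 - Xi x t).
lra.
Qed.

(** The limits are given. A fine partition of [a, s] followed by a fine one of [s, t] is a fine
    partition of [a, t], so I t - I s is approximated by sums over [s, t] alone, to which the
    uniform bound applies. *)
Lemma partition_limit_sewing m n a b (Xi : R -> R -> 'M[R]_(m, n))
    (I : R -> 'M[R]_(m, n)) (C theta : R) : 1 < theta -> 0 <= C ->
  (forall s u t, a <= s -> s <= u -> u <= t -> t <= b ->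
    `|Xi s t - Xi s u - Xi u t| <= C * (t - s) `^ theta) ->
  (forall t, a <= t -> t <= b ->
    partition_sum a t Xi @ vanishing_mesh a t --> I t) ->
  exists K, forall s t, a <= s -> s <= t -> t <= b ->
    `|I t - I s - Xi s t| <= K * (t - s) `^ theta.
Proof.
move=> th1 C0 XiC IXi.
have [K XiK] := partition_sum_sewing th1 C0 XiC; exists K => s t as_ st tb.
apply/ler_addgt0Pr => e e0.
have e20 : 0 < e / 2 by rewrite divr_gt0.
have /cvgrPdist_le/(_ _ e20)[/= d1 d10 It] := IXi t (le_trans as_ st) tb.
have /cvgrPdist_le/(_ _ e20)[/= d2 d20 Is] := IXi s as_ (le_trans st tb).
set e' := Num.min d1 d2; have d0 : 0 < e' by rewrite lt_min d10.
have ed1 : e' <= d1 by rewrite ge_min lexx.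
have ed2 : e' <= d2 by rewrite ge_min lexx orbT.
have [p [ps pm]] := exists_mesh_lt as_ d0.
have [p' [ps' pm']] := exists_mesh_lt st d0.
have {}Is := Is p (conj ps (fun n ns => lt_le_trans (pm n ns) ed2)).
have := It (p ++ p').
have pp := mesh_lt_cat ps pm pm'.
move=> /(_ (conj (itv_partition_cat ps ps')
  (fun n ns => lt_le_trans (pp n ns) ed1))) {}It.
rewrite (partition_sum_cat _ _ _ ps) in It.
have Hp' := XiK _ _ _ as_ tb ps'.
move: It Is Hp'; set A := partition_sum a s Xi p; set B := partition_sum s t Xi p'.
move=> It Is Hp'.
have -> : I t - I s - Xi s t = (I t - (A + B)) - (I s - A) + (B - Xi s t).
  by apply/matrixP => i j; rewrite !mxE; ring.
have := ler_normD ((I t - (A + B)) - (I s - A)) (B - Xi s t).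
have := ler_normB (I t - (A + B)) (I s - A).
lra.
Qed.

End sewing.

(** * Coordinatewise integrals of vector-valued paths *)

Section vec_integral.
Context {R : realType} {d : nat}.
Local Notation mu := (@lebesgue_measure R).
Implicit Types (a b c : R) (g h : R -> 'cV[R]_d).

Definition vec_integrable a b g :=
  forall i, mu.-integrable `[a, b] (EFin \o (fun r => g r i 0)).

Lemma continuous_vec_integrable a b g :
  {within `[a, b], continuous g} -> vec_integrable a b g.
Proof.
move=> gc i; apply: continuous_compact_integrable; first exact: segment_compact.
move=> x; apply: (@continuous_comp _ _ R^o (g : subspace `[a, b] -> _)
  (fun v : 'cV[R]_d => v i 0)); first exact: gc.
exact: coord_continuous.
Qed.

Lemma vec_integrableS a b a' b' g : a <= a' -> b' <= b ->
  vec_integrable a b g -> vec_integrable a' b' g.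
Proof.
move=> aa bb gi i; apply: integrableS (gi i) => // x /=.
by rewrite !in_itv/= => /andP[ax xb]; rewrite (le_trans aa ax) (le_trans xb).
Qed.

Lemma vec_integral_itvS a b c g : a <= b -> b <= c -> vec_integrable a c g ->
  vec_integral a c g = vec_integral a b g + vec_integral b c g.
Proof.
move=> ab bc gi; apply/colP => i; rewrite !mxE.
have := @Rintegral_itvB R (fun r => g r i 0) (BLeft a) (BRight c) b (gi i).
rewrite !bnd_simp => /(_ ab bc) /eqP; rewrite subr_eq addrC => /eqP ->.
rewrite Rintegral_itv_obnd_cbnd//.
apply: integrableS (gi i) => // x /=.
by rewrite !in_itv/= => /andP[/ltW bx ->]; rewrite (le_trans ab bx).
Qed.

Lemma vec_integralxx a g : vec_integral a a g = 0.
Proof.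
by apply/colP => i; rewrite !mxE set_itv1 Rintegral_set1.
Qed.

Lemma vec_integral_cst a b (v : 'cV[R]_d) : a <= b ->
  vec_integral a b (fun=> v) = (b - a) *: v.
Proof.
move=> ab; apply/colP => i; rewrite !mxE Rintegral_cst//= mulrC.
by rewrite lebesgue_measure_itv/= lte_fin; case: ltgtP ab => //= -> _; rewrite subrr.
Qed.

Lemma eq_vec_integral a b g h : (forall r, a <= r <= b -> g r = h r) ->
  vec_integral a b g = vec_integral a b h.
Proof.
move=> gh; apply/colP => i; rewrite !mxE; apply: eq_Rintegral => r.
by rewrite inE/= in_itv/= => /gh ->.
Qed.

Lemma vec_integralB a b g h : vec_integrable a b g -> vec_integrable a b h ->
  vec_integral a b (fun r => g r - h r) = vec_integral a b g - vec_integral a b h.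
Proof.
move=> gi hi; apply/colP => i; rewrite !mxE.
by under eq_Rintegral do rewrite !mxE; rewrite RintegralB.
Qed.

Lemma norm_vec_integral a b g (M : R) : a <= b -> 0 <= M ->
  vec_integrable a b g -> (forall r, a <= r <= b -> `|g r| <= M) ->
  `|vec_integral a b g| <= M * (b - a).
Proof.
move=> ab M0 gi gM; apply: mx_norm_le => [|i j].
  by rewrite mulr_ge0// subr_ge0.
rewrite ord1 mxE (le_trans (le_normr_Rintegral _ (gi i)))//.
apply: (@le_trans _ _ (\int[mu]_(r in `[a, b]) M)%R).
  apply: le_Rintegral => //.
  - by have := integrable_norm (gi i).
  - apply: continuous_compact_integrable; first exact: segment_compact.
    by move=> x; exact: cvg_cst.
  - by move=> r; rewrite /= in_itv/= => /gM; exact: le_trans (ler_mx_coord _ _ _).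
rewrite Rintegral_cst//= lebesgue_measure_itv/= lte_fin.
by case: ltgtP ab => //= -> _; rewrite subrr.
Qed.

Lemma vec_integral_mulmx a b g (S : 'M[R]_d) : vec_integrable a b g ->
  vec_integral a b (fun r => S *m g r) = S *m vec_integral a b g.
Proof.
move=> gi; apply/colP => i; rewrite !mxE.
under eq_Rintegral do rewrite mxE.
under [in RHS]eq_bigr do rewrite mxE.
have int_k k : mu.-integrable `[a, b] (EFin \o (fun r => S i k * g r k 0)).
  exact: (integrableZl _ (S i k) (gi k)).
elim: (index_enum _) => [|k s ih].
  by under eq_Rintegral do rewrite big_nil; rewrite big_nil Rintegral_cst// mul0r.
under eq_Rintegral do rewrite big_cons.
rewrite big_cons -ih RintegralD//; first by rewrite RintegralZl.
rewrite (_ : _ \o _ = fun r => (\sum_(k <- s) (S i k * g r k 0)%:E)%E).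
  by apply: integrable_sum => // j _; exact: int_k.
by apply/funext => r /=; rewrite sumEFin.
Qed.

End vec_integral.

(** * Continuity and differentiability of matrix products *)

Section mulmx_limits.
Context {R : realType} {m n p : nat}.

Lemma cvg_mulmx (T : Type) (F : set_system T) (FF : Filter F)
    (f : T -> 'M[R]_(m, n)) (g : T -> 'M[R]_(n, p))
    (a : 'M[R]_(m, n)) (b : 'M[R]_(n, p)) :
  f @ F --> a -> g @ F --> b -> (fun x => f x *m g x) @ F --> a *m b.
Proof.
move=> fa gb; apply/cvgrPdist_le => e e0.
pose D : R := n%:R * (`|b| + `|a| + 1) + 1.
have D0 : 0 < D by rewrite ltr_wpDl// mulr_ge0// !addr_ge0.
pose dl := Num.min 1 (e / D).
have dl0 : 0 < dl by rewrite lt_min ltr01 divr_gt0.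
move/cvgrPdist_le : fa => /(_ _ dl0) fa.
move/cvgrPdist_le : gb => /(_ _ dl0) gb.
near=> x.
have fx : `|a - f x| <= dl by near: x.
have gx : `|b - g x| <= dl by near: x.
have -> : a *m b - f x *m g x
    = (a - f x) *m b + a *m (b - g x) - (a - f x) *m (b - g x).
  rewrite !mulmxBl !mulmxBr.
  by apply/matrixP => i j; rewrite !mxE; ring.
have d1 : dl <= 1 by rewrite ge_min lexx.
have dD : dl * D <= e by rewrite -ler_pdivlMr// ge_min lexx orbT.
have H1 : `|(a - f x) *m b| <= n%:R * dl * `|b|.
  by rewrite (le_trans (ler_norm_mulmx _ _))// ler_wpM2r// ler_wpM2l.
have H2 : `|a *m (b - g x)| <= n%:R * `|a| * dl.
  by rewrite (le_trans (ler_norm_mulmx _ _))// ler_wpM2l// mulr_ge0.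
have H3 : `|(a - f x) *m (b - g x)| <= n%:R * dl.
  rewrite (le_trans (ler_norm_mulmx _ _))// -mulrA ler_wpM2l//.
  by rewrite -[leRHS]mulr1 ler_pM// (le_trans gx).
have := ler_normB ((a - f x) *m b + a *m (b - g x)) ((a - f x) *m (b - g x)).
have := ler_normD ((a - f x) *m b) (a *m (b - g x)).
have : n%:R * dl * `|b| + n%:R * `|a| * dl + n%:R * dl <= e.
  apply: le_trans dD; rewrite /D.
  have -> : n%:R * dl * `|b| + n%:R * `|a| * dl + n%:R * dl =
    dl * (n%:R * (`|b| + `|a| + 1)) by ring.
  by rewrite ler_pM2l// lerDl.
lra.
Unshelve. all: by end_near. Qed.

Lemma continuous_mulmx (T : topologicalType) (f : T -> 'M[R]_(m, n))
    (g : T -> 'M[R]_(n, p)) :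
  continuous f -> continuous g -> continuous (fun x => f x *m g x).
Proof. by move=> fc gc x; apply: cvg_mulmx; [exact: fc|exact: gc]. Qed.

Lemma is_diff_mulmx (V : normedModType R) (x : V) (S : 'M[R]_(m, n))
    (f df : V -> 'M[R]_(n, p)) :
  is_diff x f df -> is_diff x (fun y => S *m f y) (fun v => S *m df v).
Proof.
move=> fd; have Sc := @mulmx_continuous R m n p S.
have Sd : is_diff (f x) (mulmx S : 'M[R]_(n, p) -> _) (mulmx S).
  by apply: DiffDef; [exact: linear_differentiable|exact: diff_lin].
exact: (is_diff_comp fd Sd).
Qed.

End mulmx_limits.

(** * Bounds on sigma^-1 from ellipticity *)

Section elliptic.
Context {R : realType} {d : nat}.
Variables (sigma : 'cV[R]_d -> 'M[R]_d) (M lambda : R).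
Hypothesis lambda0 : 0 < lambda.
Hypothesis sigma_elliptic : forall v x : 'cV[R]_d,
  lambda * \sum_i v i 0 ^+ 2 <= `|(v^T *m sigma x *m v) 0 0|.
Hypothesis sigma_bounded : forall x, `|sigma x| <= M.
Hypothesis sigma_lipschitz : forall x y, `|sigma x - sigma y| <= M * `|x - y|.

Lemma sqr_norm_le_sum n (v : 'cV[R]_n) : `|v| ^+ 2 <= \sum_i v i 0 ^+ 2.
Proof.
have S0 : 0 <= \sum_i v i 0 ^+ 2 by apply: sumr_ge0 => i _; exact: sqr_ge0.
rewrite -(sqr_sqrtr S0) ler_sqr ?nnegrE ?sqrtr_ge0//.
apply: mx_norm_le => [|i j]; first exact: sqrtr_ge0.
rewrite ord1 -sqrtr_sqr ler_wsqrtr// (bigD1 i)//= lerDl.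
by apply: sumr_ge0 => k _; exact: sqr_ge0.
Qed.

Lemma norm_dot_le (u v : 'cV[R]_d) : `|(u^T *m v) 0 0| <= d%:R * `|u| * `|v|.
Proof.
rewrite (le_trans (ler_mx_coord _ _ _))// (le_trans (ler_norm_mulmx _ _))//.
by rewrite normr_trmx.
Qed.

Local Notation A := (fun x => invmx (sigma x)).

(** The quadratic form vanishes on a left kernel vector, which ellipticity then forces to be
    zero. *)
Lemma elliptic_unitmx x : sigma x \in unitmx.
Proof.
rewrite unitmxE unitfE; apply/det0P => -[v v0 vs].
have := sigma_elliptic v^T x; rewrite trmxK vs mul0mx mxE normr0 => H.
move/negP: v0; apply; rewrite -(trmxK v) trmx_eq0 -normr_eq0 -sqrf_eq0.
rewrite eq_le sqr_ge0 andbT -(pmulr_rle0 _ lambda0).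
by apply: le_trans H; rewrite ler_pM2l// sqr_norm_le_sum.
Qed.

Lemma mul_sigma_invsigma x (v : 'cV[R]_d) : sigma x *m (A x *m v) = v.
Proof. by rewrite mulmxA mulmxV ?elliptic_unitmx// mul1mx. Qed.

Lemma mul_invsigma_sigma x (v : 'cV[R]_d) : A x *m (sigma x *m v) = v.
Proof. by rewrite mulmxA mulVmx ?elliptic_unitmx// mul1mx. Qed.

(** Ellipticity is tested on w = sigma^-1 v, where the form is w^T v, only linear in |w|; one factor
    |w| cancels. *)
Lemma norm_invsigma_mul x (v : 'cV[R]_d) : `|A x *m v| <= d%:R / lambda * `|v|.
Proof.
set w := A x *m v; have [w0|w0] := eqVneq `|w| 0.
  by rewrite w0 mulr_ge0// divr_ge0// ltW.
have {}w0 : 0 < `|w| by rewrite lt_def w0/=.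
rewrite mulrAC ler_pdivlMr// mulrC -(ler_pM2r w0).
have -> : lambda * `|w| * `|w| = lambda * `|w| ^+ 2 by ring.
have -> : d%:R * `|v| * `|w| = d%:R * `|w| * `|v| by ring.
apply: (@le_trans _ _ (lambda * \sum_i w i 0 ^+ 2)).
  by rewrite ler_pM2l// sqr_norm_le_sum.
apply: le_trans (sigma_elliptic w x) _.
by rewrite -mulmxA mul_sigma_invsigma norm_dot_le.
Qed.

Lemma norm_invsigma x : `|A x| <= d%:R / lambda.
Proof.
apply: mx_norm_le => [|i j]; first by rewrite divr_ge0// ltW.
have -> : A x i j = (A x *m delta_mx j 0 : 'cV[R]_d) i 0.
  by rewrite -colE mxE.
rewrite (le_trans (ler_mx_coord _ _ _))// (le_trans (norm_invsigma_mul _ _))//.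
rewrite -[leRHS]mulr1 ler_wpM2l ?divr_ge0 ?(ltW lambda0)//.
apply: mx_norm_le => // k l; rewrite mxE.
by case: (_ && _); rewrite ?normr1 ?normr0.
Qed.

(** Resolvent identity. The constant later bounds the second-order remainder of G. *)
Lemma invsigma_lipschitz : exists2 L, 0 <= L &
  forall x y, `|A x - A y| <= L * `|x - y|.
Proof.
have M0 : 0 <= M by rewrite (le_trans _ (sigma_bounded 0)).
have a0 : 0 <= d%:R / lambda by rewrite divr_ge0// ltW.
exists (d%:R * (d%:R * (d%:R / lambda) * M) * (d%:R / lambda)).
  by rewrite !mulr_ge0// ?invr_ge0 ltW.
move=> x y.
have -> : A x - A y = A x *m (sigma y - sigma x) *m A y.
  rewrite mulmxBr mulmxBl mulVmx ?elliptic_unitmx// mul1mx.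
  by rewrite -mulmxA mulmxV ?elliptic_unitmx// mulmx1.
rewrite (le_trans (ler_norm_mulmx _ _))//.
have -> : d%:R * (d%:R * (d%:R / lambda) * M) * (d%:R / lambda) * `|x - y| =
  d%:R * (d%:R * (d%:R / lambda) * (M * `|x - y|)) * (d%:R / lambda) by ring.
apply: ler_pM; rewrite ?mulr_ge0//; last exact: norm_invsigma.
rewrite ler_wpM2l// (le_trans (ler_norm_mulmx _ _))//.
apply: ler_pM; rewrite ?mulr_ge0//; first by rewrite ler_wpM2l// norm_invsigma.
by rewrite distrC.
Qed.

(** Substituting v = sigma w turns the form of sigma^-1 at v into the transpose of the form of sigma
    at w, the same scalar, and |v| <= K |w| converts the lower bound. *)
Lemma invsigma_form : exists2 mu, 0 < mu &
  forall x (v : 'cV[R]_d), mu * `|v| ^+ 2 <= `|(v^T *m A x *m v) 0 0|.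
Proof.
have M0 : 0 <= M by rewrite (le_trans _ (sigma_bounded 0)).
pose K := d%:R * M + 1; have K0 : 0 < K by rewrite ltr_wpDl// mulr_ge0.
exists (lambda / K ^+ 2); first by rewrite divr_gt0// exprn_gt0.
move=> x v; set w := A x *m v.
have vw : v = sigma x *m w by rewrite mul_sigma_invsigma.
have vK : `|v| <= K * `|w|.
  rewrite vw (le_trans (ler_norm_mulmx _ _))// ler_wpM2r//.
  by rewrite (@le_trans _ _ (d%:R * M))// ?ler_wpM2l// lerDl.
apply: (@le_trans _ _ (lambda * \sum_i w i 0 ^+ 2)).
  rewrite -mulrA ler_pM2l// mulrC ler_pdivrMr ?exprn_gt0//.
  apply: (@le_trans _ _ (`|w| ^+ 2 * K ^+ 2)).
    by rewrite -exprMn ler_sqr ?nnegrE ?mulr_ge0// ?(ltW K0)// mulrC.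
  by rewrite ler_pM2r ?exprn_gt0// sqr_norm_le_sum.
apply: (le_trans (sigma_elliptic w x)).
have -> : v^T *m A x *m v = (w^T *m sigma x *m w)^T.
  by rewrite -!mulmxA -/w -vw trmx_mul trmxK.
by rewrite [X in _ <= `|X|]mxE.
Qed.

End elliptic.

(** * The potential of a conservative Lipschitz field *)

Section potential.
Context {R : realType} {d : nat}.
Variables (A : 'cV[R]_d -> 'M[R]_d) (L : R).
Hypothesis L0 : 0 <= L.
Hypothesis A_lipschitz : forall x y, `|A x - A y| <= L * `|x - y|.
Hypothesis A_conservative : conservative A.

Let A_continuous : continuous A := lipschitz_continuous A_lipschitz.

Section smooth_path.
Variables (gamma dgamma : R -> 'cV[R]_d).
Hypothesis gammaD : forall t : R, is_derive t 1 gamma (dgamma t).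
Hypothesis dgammaC : continuous dgamma.

Let gammaC : continuous gamma.
Proof.
by move=> t; apply: differentiable_continuous; apply/derivable1_diffP.
Qed.

Lemma smooth_piecewise_C1 a b : a < b -> piecewise_C1 gamma a b.
Proof.
move=> ab; apply: (piecewise_C1_smooth (dgamma := dgamma)) => //.
- exact: continuous_subspaceT.
- exact: continuous_subspaceT.
Qed.

Lemma smooth_path_integrable a b :
  vec_integrable a b (fun r => A (gamma r) *m 'D_1 gamma r).
Proof.
apply: continuous_vec_integrable; apply: continuous_subspaceT.
have -> : (fun r => A (gamma r) *m 'D_1 gamma r)
    = (fun r => A (gamma r) *m dgamma r).
  by apply/funext => r; rewrite (@derive_val _ _ _ _ _ _ _ (gammaD r)).
apply: continuous_mulmx => // t.
by apply: continuous_comp; [exact: gammaC|exact: A_continuous].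
Qed.

End smooth_path.

Definition line (p w : 'cV[R]_d) (t : R) := p + t *: w.

Lemma is_derive_affine p w (t : R) : is_derive t 1 (line p w) w.
Proof. exact: (is_derive_line (is_diff_id (p + t *: w))). Qed.

Lemma line_piecewise_C1 p w : piecewise_C1 (line p w) 0 1.
Proof.
apply: (smooth_piecewise_C1 (is_derive_affine p w)) => //.
by move=> t; exact: cvg_cst.
Qed.

Lemma path_integral_line p w :
  path_integral A (line p w) 0 1 = vec_integral 0 1 (fun t => A (line p w t) *m w).
Proof.
apply: eq_vec_integral => r _.
by rewrite (@derive_val _ _ _ _ _ _ _ (is_derive_affine p w r)).
Qed.

Definition potential z := path_integral A (line 0 z) 0 1.

(* The parabola through 0, z and z + h is a smooth path; cutting it at z
   and comparing each half with a segment spares concatenated paths. *)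
Lemma potentialD z h :
  potential (z + h) - potential z = path_integral A (line z h) 0 1.
Proof.
(* [q] vanishes at 0 and 1 and equals 1 at 2, so [gamma] visits 0, z and 2 z + (h - z) = z + h at
   these times. *)
pose q (t : R) : R := t * (t - 1) / 2.
pose gamma (t : R) := t *: z + q t *: (h - z).
pose dgamma (t : R) := z + (t - 2^-1) *: (h - z).
have gammaD (t : R) : is_derive t 1 gamma (dgamma t).
  have dq : is_derive t 1 q (t - 2^-1).
    by rewrite /q; apply: is_derive_eq; rewrite /GRing.scale/=; field.
  have d1 := is_derive_scalel z (is_derive_id t 1); rewrite scale1r in d1.
  have d2 := is_derive_scalel (h - z) dq.
  exact: (@is_deriveD _ _ _ (fun t : R => t *: z) (fun t => q t *: (h - z))).
have dgammaC : continuous dgamma.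
  move=> t; apply: cvgD; first exact: cvg_cst.
  apply: cvgZl; apply: cvgB; [exact: cvg_id|exact: cvg_cst].
have g0 : gamma 0 = 0 by rewrite /gamma /q !scale0r mul0r mul0r scale0r addr0.
have g1 : gamma 1 = z.
  by rewrite /gamma /q subrr mulr0 mul0r scale1r scale0r addr0.
have g2 : gamma 2 = z + h.
  rewrite /gamma /q; have -> : (2 * (2 - 1) / 2 : R) = 1 by field.
  by apply/colP => i; rewrite !mxE; ring.
have l0 p w : line p w 0 = p by rewrite /line scale0r addr0.
have l1 p w : line p w 1 = p + w by rewrite /line scale1r.
have C := smooth_piecewise_C1 gammaD dgammaC.
have -> : potential (z + h) = path_integral A gamma 0 2.
  apply: A_conservative; first exact: line_piecewise_C1.
  - exact: C.
  - by rewrite l0 g0.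
  - by rewrite l1 add0r g2.
have -> : potential z = path_integral A gamma 0 1.
  apply: A_conservative; first exact: line_piecewise_C1.
  - exact: C.
  - by rewrite l0 g0.
  - by rewrite l1 add0r g1.
have -> : path_integral A (line z h) 0 1 = path_integral A gamma 1 2.
  apply: A_conservative; first exact: line_piecewise_C1.
  - by apply: C; rewrite ltr1n.
  - by rewrite l0 g1.
  - by rewrite l1 g2.
apply/eqP; rewrite subr_eq addrC; apply/eqP; apply: vec_integral_itvS => //.
  by rewrite ler1n.
exact: (smooth_path_integrable gammaD dgammaC 0 2).
Qed.

(** The increment is the integral of [A] along the segment from z to z + w, on which [A] differs
    from [A z] by at most L |w|. *)
Lemma potential_quadratic z w :
  `|potential (z + w) - potential z - A z *m w| <= d%:R * L * `|w| ^+ 2.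
Proof.
rewrite potentialD path_integral_line.
have lc : continuous (line z w).
  move=> t; apply: differentiable_continuous; apply/derivable1_diffP.
  by case: (is_derive_affine z w t).
have i1 : vec_integrable 0 1 (fun t => A (line z w t) *m w).
  apply: continuous_vec_integrable; apply: continuous_subspaceT.
  apply: continuous_mulmx; last by move=> t; exact: cvg_cst.
  by move=> t; apply: continuous_comp; [exact: lc|exact: A_continuous].
have i2 : vec_integrable 0 1 (fun _ : R => A z *m w).
  apply: continuous_vec_integrable; apply: continuous_subspaceT.
  by move=> t; exact: cvg_cst.
have := vec_integral_cst (A z *m w) (@ler01 R); rewrite subr0 scale1r => <-.
rewrite -vec_integralB// -[leRHS]mulr1 -[X in _ <= _ * X]subr0.
apply: norm_vec_integral => //.
- by rewrite !mulr_ge0.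
- move=> i.
  have := continuous_vec_integrable
    (g := fun t => A (line z w t) *m w - A z *m w).
  move=> /(_ 0 1) H; apply: H; apply: continuous_subspaceT => t.
  apply: cvgB; last exact: cvg_cst.
  apply: cvg_mulmx; last exact: cvg_cst.
  by apply: continuous_comp; [exact: lc|exact: A_continuous].
- move=> r /andP[r0 r1]; rewrite -mulmxBl (le_trans (ler_norm_mulmx _ _))//.
  rewrite expr2 mulrA ler_wpM2r// -mulrA ler_wpM2l//.
  rewrite (le_trans (A_lipschitz _ _))// ler_wpM2l//.
  by rewrite /line addrC addKr normrZ ger0_norm// ler_piMl.
Qed.

Lemma is_diff_potential z : is_diff z potential (mulmx (A z)).
Proof.
exact: (@is_diff_quadratic _ _ _ _ _ (mulmx (A z)) _ (@mulmx_continuous _ _ _ _ _)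
  (potential_quadratic z)).
Qed.

End potential.

(** * Global inversion of G *)

Section global_inverse.
Context {R : realType} {d : nat}.
Variables (G : 'cV[R]_d -> 'cV[R]_d) (A S : 'cV[R]_d -> 'M[R]_d) (K M mu : R).
Hypothesis mu0 : 0 < mu.
Hypothesis A_form : forall x (v : 'cV[R]_d),
  mu * `|v| ^+ 2 <= `|(v^T *m A x *m v) 0 0|.
Hypothesis mulSA : forall x (v : 'cV[R]_d), S x *m (A x *m v) = v.
Hypothesis mulAS : forall x (v : 'cV[R]_d), A x *m (S x *m v) = v.
Hypothesis S_bounded : forall x, `|S x| <= M.
Hypothesis G_diff : forall z, is_diff z G (mulmx (A z)).
Hypothesis K0 : 0 <= K.
Hypothesis G_quadratic : forall z w,
  `|G (z + w) - G z - A z *m w| <= K * `|w| ^+ 2.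

(** Pairing G with v = x - y reduces to a scalar function on the segment whose derivative is the
    form of [A] at v. The mean value theorem involves one intermediate point, so a bound on the
    absolute value of the form is enough. *)
Lemma norm_le_monotone x y : mu * `|x - y| <= d%:R * `|G x - G y|.
Proof.
set v := x - y; have [->|v0] := eqVneq `|v| 0.
  by rewrite mulr0 mulr_ge0.
have {}v0 : 0 < `|v| by rewrite lt_def v0/=.
pose f z := v^T *m G z.
have fD z : is_diff z f (fun w => v^T *m (A z *m w)) by exact: is_diff_mulmx.
have lD (t : R) : is_derive t 1 (fun s => f (y + s *: v) 0 0)
    ((v^T *m A (y + t *: v) *m v) 0 0).
  rewrite -mulmxA; apply: is_derive_mx.
  exact: (is_derive_line (fD (y + t *: v))).
have hc : {within `[0, 1], continuous (fun s => f (y + s *: v) 0 0)}.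
  apply: continuous_subspaceT => t; apply: differentiable_continuous.
  by apply/derivable1_diffP; have [] := lD t.
have [c _] := MVT ltr01 (fun t _ => lD t) hc.
rewrite subr0 mulr1 scale1r scale0r addr0 subrKC /f => E.
rewrite -(ler_pM2r v0) -mulrA -expr2 (le_trans (A_form (y + c *: v) v))//.
rewrite -E.
have -> : (v^T *m G x) 0 0 - (v^T *m G y) 0 0 = (v^T *m (G x - G y)) 0 0.
  by rewrite mulmxBr [RHS]mxE [X in _ = _ + X]mxE.
by rewrite (le_trans (norm_dot_le _ _))// mulrAC.
Qed.

Lemma global_min_sum_sqr y : exists x, forall x',
  \sum_i ((G x - y) i 0) ^+ 2 <= \sum_i ((G x' - y) i 0) ^+ 2.
Proof.
pose g x := \sum_i ((G x - y) i 0) ^+ 2.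
have g_ge0 x : 0 <= g x by apply: sumr_ge0 => i _; exact: sqr_ge0.
have Gc : continuous G.
  by move=> z; apply: differentiable_continuous; exact: ex_diff.
have gc : continuous g.
  move=> z; rewrite /g.
  have -> : (fun x => \sum_i ((G x - y) i 0) ^+ 2) =
    \sum_i (fun x => ((G x - y) i 0) ^+ 2) by apply/funext => x; rewrite fct_sumE.
  apply: (@big_ind _ (fun h : 'cV[R]_d -> R => {for z, continuous h})) => /=.
  - exact: (@cst_continuous _ _ (0 : R)).
  - by move=> h1 h2 c1 c2; apply: (@continuousD _ R^o).
  - move=> i _; have c1 : {for z, continuous (fun x => (G x - y) i 0)}.
      apply: (@continuous_comp _ _ R^o (fun x => G x - y)
        (fun v : 'cV[R]_d => v i 0)).
        by apply: (@continuousB _ _ _ G (cst y)); [exact: Gc|exact: cst_continuous].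
      exact: coord_continuous.
    apply: (@continuous_comp _ _ _ (fun x => (G x - y) i 0) (fun t : R => t ^+ 2)).
      exact: c1.
    exact: exprn_continuous.
pose s := Num.sqrt (g 0).
have s0 : 0 <= s by exact: sqrtr_ge0.
have s_ge x : `|G x - y| <= Num.sqrt (g x).
  by rewrite -(ger0_norm (normr_ge0 _)) -sqrtr_sqr ler_wsqrtr// sqr_norm_le_sum.
(* A point with |G x' - y| <= s lies within 2 s of G 0 in the image, hence in the ball of radius [r]
   by [norm_le_monotone]. Outside this ball the value at 0 cannot be beaten. *)
pose r := d%:R * (s + s) / mu.
have r0 : 0 <= r by rewrite !mulr_ge0 ?addr_ge0// invr_ge0 ltW.
(* Compactness and the extreme value theorem are applied to row vectors, hence the
   transpositions. *)
pose B := [set u : 'rV[R]_d | `|u| <= r].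
have B0 : B !=set0 by exists 0; rewrite /B/= normr0.
have Bcpt : compact B.
  apply: bounded_closed_compact.
    by exists r; split; [exact: num_real|move=> t rt u /= /le_trans; apply; exact: ltW].
  have -> : B = (fun u : 'rV[R]_d => `|u|) @^-1` [set t | t <= r] by [].
  apply: closed_comp; last exact: closed_le.
  by move=> u _; exact: norm_continuous.
have gTc : {within B, continuous (fun u : 'rV[R]_d => g u^T)}.
  apply: continuous_subspaceT => u.
  apply: (@continuous_comp _ _ _ (fun u : 'rV[R]_d => u^T) g); last exact: gc.
  move: u; apply: (@lipschitz_continuous R _ _ _ 1) => u v.
  by rewrite -linearB/= normr_trmx mul1r.
have [u _ umin] := EVT_min_rV B0 Bcpt gTc.
exists u^T => x'; rewrite -/(g _) -/(g _).
have [xr|xr] := leP `|x'| r.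
  by have := umin x'^T; rewrite trmxK; apply; rewrite inE /B/= normr_trmx.
apply: (@le_trans _ _ (g 0)).
  by have := umin 0; rewrite trmx0; apply; rewrite inE /B/= normr0.
rewrite leNgt; apply/negP => gx.
have gs : Num.sqrt (g x') <= s by rewrite ler_wsqrtr// ltW.
have : `|G x' - G 0| <= s + s.
  have -> : G x' - G 0 = (G x' - y) - (G 0 - y) by rewrite opprB subrKA.
  by rewrite (le_trans (ler_normB _ _))// lerD// (le_trans (s_ge _)).
move=> H; have := norm_le_monotone x' 0; rewrite subr0 leNgt => /negP; apply.
apply: (@le_lt_trans _ _ (d%:R * (s + s))); first by rewrite ler_wpM2l.
by rewrite [ltRHS]mulrC -ltr_pdivrMr.
Qed.

Lemma global_min_root x y : (forall x',
    \sum_i ((G x - y) i 0) ^+ 2 <= \sum_i ((G x' - y) i 0) ^+ 2) ->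
  G x = y.
Proof.
move=> xmin; set u := G x - y; pose v := - (S x *m u).
have hD (t : R) i : is_derive t 1 (fun t => (G (x + t *: v) - y) i 0)
    ((A (x + t *: v) *m v) i 0).
  have H := is_derive_line (w := v) (G_diff (x + t *: v)).
  have H2 : is_derive t 1 ((fun t => G (x + t *: v)) - cst y)
    (A (x + t *: v) *m v - 0) by exact: is_deriveB.
  by rewrite subr0 in H2; exact: (is_derive_mx i 0 H2).
pose h (t : R) := \sum_i ((G (x + t *: v) - y) i 0) ^+ 2.
have hE : h = \sum_i (fun t : R => (G (x + t *: v) - y) i 0) ^+ 2.
  by apply/funext => t; rewrite fct_sumE; apply: eq_bigr => i _; rewrite exprfctE.
have hd (t : R) : is_derive t 1 h (\sum_i
    (2 * (G (x + t *: v) - y) i 0 * ((A (x + t *: v) *m v) i 0))).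
  by rewrite hE; apply: is_derive_sum.
(* Fermat's rule at the interior point 0. The other expression for this derivative is -2 times the
   sum of the squares of [u]. *)
have h0 : is_derive (0 : R) 1 h 0.
  apply: (@derive1_at_min _ h (-1) 1).
  - by lra.
  - by move=> t _; case: (hd t).
  - by rewrite in_itv/=; lra.
  - move=> t _; have := xmin (x + t *: v); rewrite /h scale0r addr0; exact.
have := @derive_val _ _ _ _ _ _ _ (hd 0).
rewrite (@derive_val _ _ _ _ _ _ _ h0) scale0r addr0 -/u.
have -> : A x *m v = - u by rewrite mulmxN mulAS.
move=> E; apply/eqP; rewrite -subr_eq0 -/u -normr_eq0 -sqrf_eq0 eq_le sqr_ge0 andbT.
rewrite (le_trans (sqr_norm_le_sum u))//.
have : \sum_i 2 * u i 0 * (- u) i 0 = - 2 * \sum_i u i 0 ^+ 2.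
  by rewrite mulr_sumr; apply: eq_bigr => i _; rewrite [(- u) i 0]mxE; ring.
rewrite -E => /eqP; rewrite eq_sym mulNr oppr_eq0 mulf_eq0 pnatr_eq0/= => /eqP ->.
by [].
Qed.

(** No local inversion theorem is involved: [norm_le_monotone] read backwards gives injectivity of G
    and the Lipschitz bound on F, and the remainder of F at z is, up to sign, [S (F z)] applied to
    that of G. *)
Lemma global_inverse : exists F : 'cV[R]_d -> 'cV[R]_d,
  [/\ cancel G F, cancel F G,
      (exists2 L, 0 <= L & forall y y', `|F y - F y'| <= L * `|y - y'|) &
      forall z, is_diff z F (mulmx (S (F z)))].
Proof.
have surj y : exists x, G x = y.
  by have [x /global_min_root] := global_min_sum_sqr y; exists x.
pose F y := sval (cid (surj y)).
have FK : cancel F G by move=> y; exact: svalP (cid (surj y)).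
have L0 : 0 <= d%:R / mu by rewrite mulr_ge0// invr_ge0 ltW.
have FL y y' : `|F y - F y'| <= d%:R / mu * `|y - y'|.
  have := norm_le_monotone (F y) (F y'); rewrite !FK => H.
  by rewrite mulrAC ler_pdivlMr// mulrC.
exists F; split => //.
- move=> x; apply/eqP; rewrite -subr_eq0 -normr_eq0 eq_le normr_ge0 andbT.
  rewrite -(pmulr_rle0 _ mu0) (le_trans (norm_le_monotone _ _))// FK.
  by rewrite subrr normr0 mulr0.
- by exists (d%:R / mu).
- move=> z; have M0 : 0 <= M by rewrite (le_trans _ (S_bounded 0)).
  apply: (@is_diff_quadratic _ _ _ _ _ (mulmx (S (F z)))
    (d%:R * M * (K * (d%:R / mu) ^+ 2)) (@mulmx_continuous _ _ _ _ _)) => w.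
  set x := F z; set x' := F (z + w).
  have xx : `|x' - x| <= d%:R / mu * `|w|.
    by rewrite (le_trans (FL _ _))// [z + w]addrC addrK.
  have q := G_quadratic x (x' - x).
  have Gx : G x = z by exact: FK.
  have Gx' : G x' = z + w by exact: FK.
  rewrite subrKC Gx Gx' [z + w]addrC addrK in q.
  have -> : x' - x - S x *m w = - (S x *m (w - A x *m (x' - x))).
    by rewrite mulmxBr mulSA opprB.
  rewrite normrN (le_trans (ler_norm_mulmx _ _))//.
  rewrite -[leRHS]mulrA; apply: ler_pM; rewrite ?mulr_ge0//.
    by rewrite ler_wpM2l.
  rewrite (le_trans q)// -mulrA ler_wpM2l//.
  by rewrite -exprMn ler_sqr ?nnegrE ?mulr_ge0 ?invr_ge0 ?(ltW mu0).
Qed.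

End global_inverse.

(** * Taylor expansions of F from the equation DF = sigma o F *)

Section flow.
Context {R : realType} {d : nat}.
Variables (F : 'cV[R]_d -> 'cV[R]_d) (sigma : 'cV[R]_d -> 'M[R]_d).
Variables (Dsigma : 'cV[R]_d -> {linear 'cV[R]_d -> 'M[R]_d}) (M L : R).
Hypothesis M0 : 0 <= M.
Hypothesis L0 : 0 <= L.
Hypothesis F_diff : forall z, is_diff z F (mulmx (sigma (F z))).
Hypothesis F_lipschitz : forall x y, `|F x - F y| <= L * `|x - y|.
Hypothesis sigma_diff : forall x, is_diff x sigma (Dsigma x).
Hypothesis sigma_bounded : forall x, `|sigma x| <= M.
Hypothesis dsigma_bounded : forall x v, `|Dsigma x v| <= M * `|v|.
Hypothesis dsigma_lipschitz : forall x y v,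
  `|Dsigma x v - Dsigma y v| <= M * `|x - y| * `|v|.

Lemma sigma_lip x y : `|sigma x - sigma y| <= M * `|x - y|.
Proof. exact: diff_bounded_lipschitz. Qed.

Lemma flow_taylor1 : exists2 C, 0 <= C & forall z w,
  `|F (z + w) - F z - sigma (F z) *m w| <= C * `|w| ^+ 2.
Proof.
have C0 : 0 <= d%:R * (M * L) by rewrite !mulr_ge0.
exists (d%:R * (M * L)) => // z w.
apply: (taylor1 F_diff) => // x y v.
rewrite -mulmxBl (le_trans (ler_norm_mulmx _ _))// ler_wpM2r//.
by rewrite -mulrA ler_wpM2l// (le_trans (sigma_lip _ _))// -mulrA ler_wpM2l.
Qed.

(** A quantitative chain rule: expand sigma at F z, then replace the increment of F by its linear
    part, an error of order |w|^2. *)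
Lemma sigma_flow_taylor1 : exists2 C, 0 <= C & forall z w,
  `|sigma (F (z + w)) - sigma (F z) - Dsigma (F z) (sigma (F z) *m w)|
    <= C * `|w| ^+ 2.
Proof.
have [C C0 FC] := flow_taylor1.
exists (M * L ^+ 2 + M * C) => [|z w].
  by rewrite addr_ge0// mulr_ge0// exprn_ge0.
set x := F z; set y := F (z + w).
have yxw : `|y - x| <= L * `|w|.
  by rewrite (le_trans (F_lipschitz _ _))// [z + w]addrC addrK.
have H1 := taylor1 sigma_diff M0 dsigma_lipschitz x (y - x).
rewrite subrKC in H1.
have H2 : `|Dsigma x (y - x - sigma x *m w)| <= M * C * `|w| ^+ 2.
  by rewrite (le_trans (dsigma_bounded _ _))// -mulrA ler_wpM2l// FC.
have -> : sigma y - sigma x - Dsigma x (sigma x *m w) =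
   (sigma y - sigma x - Dsigma x (y - x)) + Dsigma x (y - x - sigma x *m w).
  have -> : Dsigma x (y - x - sigma x *m w)
      = Dsigma x (y - x) - Dsigma x (sigma x *m w) by rewrite linearB.
  by rewrite addrA subrK.
rewrite (le_trans (ler_normD _ _))// mulrDl lerD// (le_trans H1)//.
by rewrite -mulrA ler_wpM2l// -exprMn ler_sqr ?nnegrE ?mulr_ge0.
Qed.

(** At x = F z this is D^2 F(z)(v, w), obtained by differentiating DF(z) w = sigma(F z) w in the
    direction v. *)
Definition flow_hessian x (v w : 'cV[R]_d) := Dsigma x (sigma x *m v) *m w.

(** Along the segment, the derivative of the remainder is the first-order remainder of sigma o F
    applied to w, of size |w|^3. *)
Lemma flow_taylor2 : exists2 C, 0 <= C & forall z w,
  `|F (z + w) - F z - sigma (F z) *m w - 2^-1 *: flow_hessian (F z) w w|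
    <= C * `|w| ^+ 3.
Proof.
have [C C0 SC] := sigma_flow_taylor1.
exists (d%:R * C) => [|z w]; first exact: mulr_ge0.
have -> : F (z + w) - F z - sigma (F z) *m w - 2^-1 *: flow_hessian (F z) w w =
  F (z + w) - sigma (F z) *m w - 2^-1 *: flow_hessian (F z) w w - F z.
  by apply/matrixP => i j; rewrite !mxE; ring.
have H := @mx_mean_value _ _ _ (fun t : R => F (z + t *: w)
    - t *: (sigma (F z) *m w) - (t * t / 2) *: flow_hessian (F z) w w)
  (fun t => sigma (F (z + t *: w)) *m w - sigma (F z) *m w
    - t *: flow_hessian (F z) w w) (d%:R * C * `|w| ^+ 3).
move: H; rewrite !scale1r !scale0r addr0 !mul0r scale0r !subr0 !mul1r; apply.
- move=> t.
  have d1 := is_derive_line (w := w) (F_diff (z + t *: w)).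
  have d2 := is_derive_scalel (sigma (F z) *m w) (is_derive_id t 1).
  have sq : is_derive t 1 (fun s : R => s * s / 2) t.
    by apply: is_derive_eq; rewrite /GRing.scale/=; field.
  have d3 := is_derive_scalel (flow_hessian (F z) w w) sq.
  rewrite scale1r in d2.
  exact: is_deriveB.
- move=> t /andP[t0 t1].
  have -> : sigma (F (z + t *: w)) *m w - sigma (F z) *m w -
     t *: flow_hessian (F z) w w = (sigma (F (z + t *: w)) - sigma (F z) -
      Dsigma (F z) (sigma (F z) *m (t *: w))) *m w.
    have -> : Dsigma (F z) (sigma (F z) *m (t *: w))
        = t *: Dsigma (F z) (sigma (F z) *m w) by rewrite -scalemxAr linearZ.
    by rewrite !mulmxBl -scalemxAl.
  rewrite (le_trans (ler_norm_mulmx _ _))// [`|w| ^+ 3]exprSr !mulrA ler_wpM2r//.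
  rewrite -!mulrA ler_wpM2l// (le_trans (SC _ _))// ler_wpM2l//.
  rewrite normrZ (ger0_norm t0) ler_sqr ?nnegrE ?mulr_ge0//.
  by rewrite ler_piMl.
Qed.

(** Compares the same increment from two base points; it yields the additivity defect of the germ,
    where the base points are O(h^2) apart. *)
Lemma flow_second_difference : exists2 C, 0 <= C & forall p q w,
  `|(F (p + w) - F p) - (F (q + w) - F q)| <= C * `|p - q| * `|w|.
Proof.
exists (d%:R * M * L) => [|p q w]; first by rewrite !mulr_ge0.
have H := @mx_mean_value _ _ _ (fun t : R => F (p + t *: w) - F (q + t *: w))
  (fun t => sigma (F (p + t *: w)) *m w - sigma (F (q + t *: w)) *m w)
  (d%:R * M * L * `|p - q| * `|w|).
have -> : F (p + w) - F p - (F (q + w) - F q) =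
    F (p + w) - F (q + w) - (F p - F q).
  by apply/matrixP => i j; rewrite !mxE; ring.
move: H; rewrite !scale1r !scale0r !addr0; apply.
- move=> t; have d1 := is_derive_line (w := w) (F_diff (p + t *: w)).
  have d2 := is_derive_line (w := w) (F_diff (q + t *: w)).
  exact: is_deriveB.
- move=> t _; rewrite -mulmxBl (le_trans (ler_norm_mulmx _ _))// ler_wpM2r//.
  rewrite -!mulrA ler_wpM2l// (le_trans (sigma_lip _ _))// ler_wpM2l//.
  by rewrite (le_trans (F_lipschitz _ _))// opprD addrACA subrr addr0.
Qed.

Lemma flow_hessian_lipschitz : exists2 C, 0 <= C & forall x y v,
  `|Dsigma x (sigma x *m v) - Dsigma y (sigma y *m v)|
    <= C * `|x - y| * `|v|.
Proof.
exists (M * (d%:R * M) + M * (d%:R * M)) => [|x y v].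
  by rewrite addr_ge0// !mulr_ge0.
have -> : Dsigma x (sigma x *m v) - Dsigma y (sigma y *m v) =
    (Dsigma x (sigma x *m v) - Dsigma y (sigma x *m v))
    + Dsigma y ((sigma x - sigma y) *m v).
  have -> : Dsigma y ((sigma x - sigma y) *m v)
      = Dsigma y (sigma x *m v) - Dsigma y (sigma y *m v).
    by rewrite mulmxBl linearB.
  by rewrite addrA subrK.
rewrite (le_trans (ler_normD _ _))// !mulrDl lerD//.
  rewrite (le_trans (dsigma_lipschitz _ _ _))//.
  have -> : M * (d%:R * M) * `|x - y| * `|v| = M * `|x - y| * (d%:R * M * `|v|).
    by ring.
  rewrite ler_wpM2l ?mulr_ge0// (le_trans (ler_norm_mulmx _ _))// ler_wpM2r//.
  by rewrite ler_wpM2l.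
rewrite (le_trans (dsigma_bounded _ _))// -!mulrA ler_wpM2l//.
rewrite (le_trans (ler_norm_mulmx _ _))// -mulrA ler_wpM2l// mulrA ler_wpM2r//.
exact: sigma_lip.
Qed.

(* Symmetry of second derivatives: the mixed second difference of F is
   symmetric in its two increments and equals the Hessian up to cubic terms. *)
Lemma flow_hessianC z v w :
  flow_hessian (F z) v w = flow_hessian (F z) w v.
Proof.
have [C C0 SC] := sigma_flow_taylor1.
have [C' C'0 HC] := flow_hessian_lipschitz.
have mixed v' w' : `|F (z + v' + w') - F (z + w') - (F (z + v') - F z)
    - flow_hessian (F z) v' w'| <=
    d%:R * (C * `|v'| ^+ 2 + C' * L * `|w'| * `|v'|) * `|w'|.
  have H := @mx_mean_value _ _ _ (fun t : R => F (z + v' + t *: w')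
      - F (z + t *: w') - t *: flow_hessian (F z) v' w')
    (fun t => sigma (F (z + v' + t *: w')) *m w' - sigma (F (z + t *: w')) *m w'
      - flow_hessian (F z) v' w')
    (d%:R * (C * `|v'| ^+ 2 + C' * L * `|w'| * `|v'|) * `|w'|).
  have -> : F (z + v' + w') - F (z + w') - (F (z + v') - F z)
      - flow_hessian (F z) v' w' =
    F (z + v' + w') - F (z + w') - flow_hessian (F z) v' w' - (F (z + v') - F z).
    by apply/matrixP => i j; rewrite !mxE; ring.
  move: H; rewrite !scale1r !scale0r !addr0 subr0; apply.
  - move=> t; have d1 := is_derive_line (w := w') (F_diff (z + v' + t *: w')).
    have d2 := is_derive_line (w := w') (F_diff (z + t *: w')).
    have d3 := is_derive_scalel (flow_hessian (F z) v' w') (is_derive_id t 1).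
    by rewrite scale1r in d3; exact: is_deriveB.
  - move=> t /andP[t0 t1]; rewrite /flow_hessian -!mulmxBl.
    rewrite (le_trans (ler_norm_mulmx _ _))// ler_wpM2r// ler_wpM2l//.
    have S1 := SC (z + t *: w') v'; set z' := z + t *: w' in S1 *.
    have -> : z + v' + t *: w' = z' + v' by rewrite /z' addrAC.
    have S2 := HC (F z') (F z) v'.
    have S3 : C' * `|F z' - F z| * `|v'| <= C' * L * `|w'| * `|v'|.
      rewrite ler_wpM2r// -mulrA ler_wpM2l// (le_trans (F_lipschitz _ _))//.
      rewrite ler_wpM2l// /z' [z + _]addrC addrK normrZ (ger0_norm t0).
      by rewrite ler_piMl.
    have := ler_normD (sigma (F (z' + v')) - sigma (F z')
        - Dsigma (F z') (sigma (F z') *m v'))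
      (Dsigma (F z') (sigma (F z') *m v') - Dsigma (F z) (sigma (F z) *m v')).
    rewrite subrKA; lra.
pose D := flow_hessian (F z) v w - flow_hessian (F z) w v.
pose c := d%:R * (C * `|v| ^+ 2 + C' * L * `|w| * `|v|) * `|w|
  + d%:R * (C * `|w| ^+ 2 + C' * L * `|v| * `|w|) * `|v|.
have c0 : 0 <= c.
  by rewrite /c addr_ge0// !mulr_ge0// addr_ge0// !mulr_ge0// exprn_ge0.
(* Scaling both increments by [e] scales the asymmetry by e^2 and the error by e^3, so [D] is
   smaller than any multiple of [c]. *)
have small (e : R) : 0 < e -> `|D| <= e * c.
  move=> e0; have e2 : 0 < e ^+ 2 by rewrite exprn_gt0.
  have m1 := mixed (e *: v) (e *: w); have m2 := mixed (e *: w) (e *: v).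
  rewrite -(ler_pM2l e2) -{1}(gtr0_norm e2) -normrZ.
  have -> : e ^+ 2 *: D =
      (F (z + e *: w + e *: v) - F (z + e *: v) - (F (z + e *: w) - F z)
        - flow_hessian (F z) (e *: w) (e *: v))
    - (F (z + e *: v + e *: w) - F (z + e *: w) - (F (z + e *: v) - F z)
        - flow_hessian (F z) (e *: v) (e *: w)).
    have hs a b : flow_hessian (F z) (e *: a) (e *: b)
        = e ^+ 2 *: flow_hessian (F z) a b.
      rewrite /flow_hessian -!scalemxAr.
      have -> : Dsigma (F z) (e *: (sigma (F z) *m a))
        = e *: Dsigma (F z) (sigma (F z) *m a) by rewrite linearZ.
      by rewrite -scalemxAl scalerA.
    rewrite !hs [z + e *: w + e *: v]addrAC /D.
    by apply/matrixP => i j; rewrite !mxE; ring.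
  rewrite (le_trans (ler_normB _ _))// (le_trans (lerD m2 m1))//.
  rewrite !normrZ !(gtr0_norm e0) /c le_eqVlt; apply/orP; left; apply/eqP; ring.
apply/eqP; rewrite -subr_eq0 -/D -normr_eq0 eq_le normr_ge0 andbT.
apply/ler_addgt0Pr => e e0; rewrite add0r.
have c1 : 0 < c + 1 by rewrite ltr_wpDl.
rewrite (le_trans (small (e / (c + 1)) _))//; first by rewrite divr_gt0.
by rewrite mulrAC ler_pdivrMr// ler_pM2l// lerDl.
Qed.

(** The coefficients are those of D^2 F on pairs of basis vectors, symmetric in the two indices. The
    antisymmetric part of [W], the Levy area, drops out, and the symmetric part is fixed by the
    hypothesis. *)
Lemma rough_contract_geometric z (u : 'cV[R]_d) (W : 'M[R]_d) :
  2^-1 *: (W + W^T) = 2^-1 *: (u *m u^T) ->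
  rough_contract (fun a => Dsigma (F z) (col a (sigma (F z)))) W =
  2^-1 *: flow_hessian (F z) u u.
Proof.
move=> /(scalerI _) WE.
have {}WE a k : W a k + W k a = u a 0 * u k 0.
  have := WE _; rewrite invr_eq0 pnatr_eq0 => /(_ isT) /matrixP/(_ a k).
  by rewrite !mxE big_ord1 !mxE.
apply/colP => i; rewrite mxE [RHS]mxE.
pose c a k := Dsigma (F z) (col a (sigma (F z))) i k.
have cC a k : c a k = c k a.
  have := flow_hessianC z (delta_mx a 0) (delta_mx k 0).
  rewrite /flow_hessian -!colE => /colP/(_ i).
  by rewrite !mxE.
have QE : flow_hessian (F z) u u i 0 = \sum_a \sum_k c a k * (u a 0 * u k 0).
  rewrite /flow_hessian.
  have -> : sigma (F z) *m u = \sum_a u a 0 *: col a (sigma (F z)).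
    apply/colP => j; rewrite summxE mxE; apply: eq_bigr => a _.
    by rewrite !mxE mulrC.
  rewrite linear_sum/= mulmx_suml summxE; apply: eq_bigr => a _.
  have -> : Dsigma (F z) (u a 0 *: col a (sigma (F z)))
      = u a 0 *: Dsigma (F z) (col a (sigma (F z))) by rewrite linearZ.
  rewrite -scalemxAl mxE mxE mulr_sumr; apply: eq_bigr => k _.
  by rewrite /c; ring.
have -> : (\sum_a \sum_k c a k * W a k) = 2^-1 * (\sum_a \sum_k c a k * W a k
    + \sum_a \sum_k c a k * W k a).
  have -> : \sum_a \sum_k c a k * W k a = \sum_a \sum_k c a k * W a k.
    rewrite exchange_big/=; apply: eq_bigr => a _; apply: eq_bigr => k _.
    by rewrite cC.
  by field.
congr (_ * _); rewrite QE -big_split/=.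
apply: eq_bigr => a _; rewrite -big_split/=; apply: eq_bigr => k _.
by rewrite -mulrDr WE.
Qed.

End flow.

(** * Comparison of powers of the time step *)

Section holder_scales.
Context {R : realType}.

Lemma holder_boundP (V : normedModType R) (T beta : R) (A : R -> R -> V) :
  beta != 0 -> (forall s, A s s = 0) ->
  holder_bound T beta A <-> exists2 C, 0 <= C & forall s t,
    0 <= s <= T -> 0 <= t <= T -> `|A s t| <= C * `|t - s| `^ beta.
Proof.
move=> beta0 A0; split=> [[C AC]|[C C0 AC]].
  exists `|C| => // s t sT tT; have [<-|st] := eqVneq s t.
    by rewrite A0 normr0 mulr_ge0// powR_ge0.
  have ts0 : 0 < `|t - s| `^ beta by rewrite powR_gt0// normr_gt0 subr_eq0 eq_sym.
  by rewrite -ler_pdivrMr// (le_trans (AC _ _ sT tT st))// ler_norm.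
exists C => s t sT tT st.
have ts0 : 0 < `|t - s| `^ beta by rewrite powR_gt0// normr_gt0 subr_eq0 eq_sym.
by rewrite ler_pdivrMr// AC.
Qed.

Lemma powR_natM (x alpha : R) n : x `^ (n%:R * alpha) = (x `^ alpha) ^+ n.
Proof. by rewrite mulrC powRrM powR_mulrn// powR_ge0. Qed.

(** Puts time increments on the scale h^2, with the constant T^(1 - 2 alpha). *)
Lemma ler_sqr_powR (T alpha : R) : 0 < alpha -> 2 * alpha <= 1 ->
  exists2 c, 0 <= c & forall x, 0 <= x <= T -> x <= c * (x `^ alpha) ^+ 2.
Proof.
move=> a0 a1; exists (T `^ (1 - 2 * alpha)); first exact: powR_ge0.
move=> x /andP[x0 xT]; rewrite -powR_natM.
have [->|xn0] := eqVneq x 0; first by rewrite mulr_ge0// powR_ge0.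
rewrite -{1}[x]powRr1// -{1}[1 : R](subrK (2 * alpha)) powRD ?xn0 ?implybT//.
rewrite ler_wpM2r ?powR_ge0//; apply: ge0_ler_powR; rewrite ?nnegrE ?subr_ge0//.
exact: le_trans xT.
Qed.

End holder_scales.

(** * Local expansion of F(Z) and the two limit arguments *)

Section transformed_equation.
Context {R : realType} {d : nat}.
Variables (F : 'cV[R]_d -> 'cV[R]_d) (sigma : 'cV[R]_d -> 'M[R]_d).
Variables (Dsigma : 'cV[R]_d -> {linear 'cV[R]_d -> 'M[R]_d}) (M L : R).
Hypothesis M0 : 0 <= M.
Hypothesis L0 : 0 <= L.
Hypothesis F_diff : forall z, is_diff z F (mulmx (sigma (F z))).
Hypothesis F_lipschitz : forall x y, `|F x - F y| <= L * `|x - y|.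
Hypothesis sigma_diff : forall x, is_diff x sigma (Dsigma x).
Hypothesis sigma_bounded : forall x, `|sigma x| <= M.
Hypothesis dsigma_bounded : forall x v, `|Dsigma x v| <= M * `|v|.
Hypothesis dsigma_lipschitz : forall x y v,
  `|Dsigma x v - Dsigma y v| <= M * `|x - y| * `|v|.
Variables (f g : 'cV[R]_d -> 'cV[R]_d) (Mg : R).
Hypothesis f_continuous : continuous f.
Hypothesis g_continuous : continuous g.
Hypothesis g_bounded : forall z, `|g z| <= Mg.
Hypothesis sigma_g : forall z, sigma (F z) *m g z = f (F z).
Variables (T alpha CW CZ : R) (W Z : R -> 'cV[R]_d).
Hypothesis alpha0 : 0 < alpha.
Hypothesis alpha12 : 2 * alpha <= 1.
Hypothesis alpha13 : 1 < 3 * alpha.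
Hypothesis CW0 : 0 <= CW.
Hypothesis CZ0 : 0 <= CZ.
Hypothesis W_holder : forall s t, 0 <= s -> s <= t -> t <= T ->
  `|W t - W s| <= CW * (t - s) `^ alpha.
Hypothesis Z_holder : forall s t, 0 <= s -> s <= t -> t <= T ->
  `|Z t - Z s| <= CZ * (t - s) `^ alpha.
Hypothesis Z_continuous : {within `[0, T], continuous Z}.

Let F_continuous : continuous F := lipschitz_continuous F_lipschitz.

Let Mg0 : 0 <= Mg.
Proof. by rewrite (le_trans _ (g_bounded 0)). Qed.

Definition drift t := vec_integral 0 t (fun r => g (Z r)).

Lemma within_comp_integrable (h : 'cV[R]_d -> 'cV[R]_d) a b :
  continuous h -> 0 <= a -> b <= T -> vec_integrable a b (fun r => h (Z r)).
Proof.
move=> hc a0 bT; apply: (@vec_integrableS _ _ 0 T) => //.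
apply: continuous_vec_integrable => x.
apply: (@continuous_comp _ _ _ (Z : subspace `[0, T] -> _)); last exact: hc.
exact: Z_continuous.
Qed.

Let FZ_integrable a b : 0 <= a -> b <= T ->
  vec_integrable a b (fun r => f (F (Z r))).
Proof.
apply: (within_comp_integrable (h := f \o F)) => x.
by apply: continuous_comp; [exact: F_continuous|exact: f_continuous].
Qed.

Lemma drift_increment s t : 0 <= s -> s <= t -> t <= T ->
  drift t - drift s = vec_integral s t (fun r => g (Z r)).
Proof.
move=> s0 st tT; rewrite /drift (vec_integral_itvS s0 st).
  by rewrite addrC addKr.
exact: within_comp_integrable.
Qed.

Lemma drift_lipschitz s t : 0 <= s -> s <= t -> t <= T ->
  `|drift t - drift s| <= Mg * (t - s).
Proof.
move=> s0 st tT; rewrite drift_increment// norm_vec_integral//.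
exact: within_comp_integrable.
Qed.

(** For a geometric lift this is the compensated summand of the rough integral, by [rough_germ]. *)
Definition germ s t :=
  sigma (F (Z s)) *m (W t - W s)
  + 2^-1 *: flow_hessian sigma Dsigma (F (Z s)) (W t - W s) (W t - W s).

Lemma germ_flow : exists2 C, 0 <= C & forall s t, 0 <= s -> s <= t -> t <= T ->
  `|F (Z s + (W t - W s)) - F (Z s) - germ s t| <= C * (t - s) `^ (3 * alpha).
Proof.
have [C C0 FC] := flow_taylor2 M0 L0 F_diff F_lipschitz sigma_diff
  dsigma_bounded dsigma_lipschitz.
exists (C * CW ^+ 3) => [|s t s0 st tT]; first by rewrite mulr_ge0// exprn_ge0.
rewrite /germ opprD addrA (le_trans (FC _ _))// -mulrA ler_wpM2l//.
rewrite powR_natM -exprMn lerXn2r ?nnegrE ?mulr_ge0 ?powR_ge0//.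
exact: W_holder.
Qed.

(** With w of size h and rho of size h^2 there are three errors: the Taylor remainder in rho, of
    size h^4 <= T^alpha h^3; the shift of the base point of sigma by w, costing h h^2; and the
    freezing of Z at time s under the integral, costing h (t - s). Then [sigma_g] identifies the
    integrand. *)
Lemma drift_expansion : exists2 C, 0 <= C & forall s t,
  0 <= s -> s <= t -> t <= T ->
  `|F (Z s + (W t - W s) + (drift t - drift s)) - F (Z s + (W t - W s))
    - vec_integral s t (fun r => f (F (Z r)))| <= C * (t - s) `^ (3 * alpha).
Proof.
have [C1 C10 FC] := flow_taylor1 M0 L0 F_diff F_lipschitz sigma_diff
  dsigma_bounded.
have [c c0 cP] := ler_sqr_powR T alpha0 alpha12.
have Dl x y : `|(sigma (F x) - sigma (F y))| <= M * L * `|x - y|.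
  rewrite (le_trans (sigma_lip sigma_diff dsigma_bounded _ _))//.
  by rewrite -mulrA ler_wpM2l.
exists (C1 * (Mg * c) ^+ 2 * T `^ alpha + d%:R * (M * L * CW) * (Mg * c)
  + d%:R * (M * L * CZ) * Mg * c).
  by rewrite !addr_ge0// !mulr_ge0// ?exprn_ge0 ?mulr_ge0// powR_ge0.
move=> s t s0 st tT; set w := W t - W s; set rho := drift t - drift s.
set h := (t - s) `^ alpha.
have h0 : 0 <= h by exact: powR_ge0.
have ts0 : 0 <= t - s by rewrite subr_ge0.
have tsT : t - s <= T by rewrite lerBlDr ler_wpDr.
have hT : h <= T `^ alpha.
  by apply: ge0_ler_powR; rewrite ?nnegrE ?(ltW alpha0)// (le_trans ts0).
have tsc : t - s <= c * h ^+ 2 by apply: cP; rewrite ts0.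
have wh : `|w| <= CW * h by exact: W_holder.
have rts : `|rho| <= Mg * (t - s) by exact: drift_lipschitz.
have rh : `|rho| <= Mg * c * h ^+ 2.
  by rewrite (le_trans rts)// -mulrA ler_wpM2l.
have E1 : `|F (Z s + w + rho) - F (Z s + w) - sigma (F (Z s + w)) *m rho|
    <= C1 * (Mg * c) ^+ 2 * T `^ alpha * h ^+ 3.
  rewrite (le_trans (FC _ _))//.
  have -> : C1 * (Mg * c) ^+ 2 * T `^ alpha * h ^+ 3 =
    C1 * ((Mg * c) ^+ 2 * (T `^ alpha * h ^+ 3)) by ring.
  rewrite ler_wpM2l//; apply: (@le_trans _ _ ((Mg * c * h ^+ 2) ^+ 2)).
    by rewrite lerXn2r ?nnegrE ?mulr_ge0 ?exprn_ge0.
  have -> : (Mg * c * h ^+ 2) ^+ 2 = (Mg * c) ^+ 2 * (h * h ^+ 3) by ring.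
  by rewrite ler_wpM2l ?exprn_ge0 ?mulr_ge0// ler_wpM2r// exprn_ge0.
have E2 : `|(sigma (F (Z s + w)) - sigma (F (Z s))) *m rho|
    <= d%:R * (M * L * CW) * (Mg * c) * h ^+ 3.
  rewrite (le_trans (ler_norm_mulmx _ _))//.
  have -> : d%:R * (M * L * CW) * (Mg * c) * h ^+ 3 =
    d%:R * (M * L * (CW * h)) * (Mg * c * h ^+ 2) by ring.
  apply: ler_pM; rewrite ?mulr_ge0// ler_wpM2l// (le_trans (Dl _ _))//.
  by rewrite [Z s + w]addrC addrK ler_wpM2l ?mulr_ge0.
have E3 : `|sigma (F (Z s)) *m rho - vec_integral s t (fun r => f (F (Z r)))|
    <= d%:R * (M * L * CZ) * Mg * c * h ^+ 3.
  have ig := within_comp_integrable g_continuous s0 tT.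
  rewrite /rho drift_increment// -vec_integral_mulmx//.
  have -> : vec_integral s t (fun r => f (F (Z r))) =
      vec_integral s t (fun r => sigma (F (Z r)) *m g (Z r)).
    by apply: eq_vec_integral => r _; rewrite sigma_g.
  have i1 : vec_integrable s t (fun r => sigma (F (Z s)) *m g (Z r)).
    have hc : continuous (fun z => sigma (F (Z s)) *m g z).
      apply: (@continuous_mulmx _ _ _ _ _ (cst (sigma (F (Z s)))) g) => //.
      exact: cst_continuous.
    exact: (within_comp_integrable hc s0 tT).
  have i2 : vec_integrable s t (fun r => sigma (F (Z r)) *m g (Z r)).
    have := FZ_integrable s0 tT.
    by congr vec_integrable; apply/funext => r; rewrite sigma_g.
  rewrite -vec_integralB//.
  have -> : d%:R * (M * L * CZ) * Mg * c * h ^+ 3 =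
    d%:R * (M * L * (CZ * h)) * Mg * (c * h ^+ 2) by ring.
  have B0 : 0 <= d%:R * (M * L * (CZ * h)) * Mg by rewrite !mulr_ge0.
  apply: (@le_trans _ _ (d%:R * (M * L * (CZ * h)) * Mg * (t - s))); last first.
    by rewrite ler_wpM2l.
  apply: norm_vec_integral => //.
    move=> i; have := integrableB _ (i1 i) (i2 i).
    move=> /(_ (measurable_itv _)); congr (_.-integrable _ _).
    by apply/funext => r; rewrite /= !mxE.
  move=> r /andP[sr rt]; rewrite -mulmxBl (le_trans (ler_norm_mulmx _ _))//.
  apply: ler_pM; rewrite ?mulr_ge0// ler_wpM2l// (le_trans (Dl _ _))//.
  rewrite ler_wpM2l ?mulr_ge0// distrC.
  rewrite (le_trans (Z_holder s0 sr (le_trans rt tT)))// ler_wpM2l//.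
  apply: ge0_ler_powR; rewrite ?nnegrE ?subr_ge0 ?(ltW alpha0)//.
  by rewrite lerD2r.
rewrite powR_natM -/h !mulrDl.
set I := vec_integral _ _ _ in E3 *.
have -> : F (Z s + w + rho) - F (Z s + w) - I =
   (F (Z s + w + rho) - F (Z s + w) - sigma (F (Z s + w)) *m rho)
   + (sigma (F (Z s + w)) - sigma (F (Z s))) *m rho
   + (sigma (F (Z s)) *m rho - I).
  rewrite mulmxBl; move: (_ *m rho) (_ *m rho) => a b.
  by apply/matrixP => i j; rewrite !mxE; ring.
rewrite (le_trans (ler_normD _ _))// lerD//.
by rewrite (le_trans (ler_normD _ _))// lerD.
Qed.

Lemma local_expansion : exists2 C, 0 <= C & forall s t,
  0 <= s -> s <= t -> t <= T ->
  `|F (Z s + (W t - W s) + (drift t - drift s)) - F (Z s)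
    - vec_integral s t (fun r => f (F (Z r))) - germ s t|
  <= C * (t - s) `^ (3 * alpha).
Proof.
have [C1 C10 H1] := germ_flow; have [C2 C20 H2] := drift_expansion.
exists (C1 + C2) => [|s t s0 st tT]; first exact: addr_ge0.
set p := F (Z s + (W t - W s) + (drift t - drift s)).
set I := vec_integral _ _ _; set q := F (Z s + (W t - W s)).
have -> : p - F (Z s) - I - germ s t =
    (q - F (Z s) - germ s t) + (p - q - I).
  move: (germ s t) => e; by apply/matrixP => i j; rewrite !mxE; ring.
rewrite (le_trans (ler_normD _ _))// mulrDl lerD//; first exact: H1.
exact: H2.
Qed.

(** Up to h^3 the germ is e s t = F(Z_s + W_{s,t}) - F(Z_s). The defect of e is a second difference
    with increment W_{u,t} and base points Z_s + W_{s,u} and Z_u, which the hypothesis places O(h^2)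
    apart. *)
Lemma germ_almost_additive (C : R) : 0 <= C ->
  (forall s t, 0 <= s -> s <= t -> t <= T ->
    `|Z t - Z s - (W t - W s)| <= C * (t - s) `^ (2 * alpha)) ->
  exists2 C', 0 <= C' & forall s u t, 0 <= s -> s <= u -> u <= t -> t <= T ->
    `|germ s t - germ s u - germ u t| <= C' * (t - s) `^ (3 * alpha).
Proof.
move=> C0 ZW; have [C1 C10 H1] := germ_flow.
have [C2 C20 H2] := flow_second_difference M0 L0 F_diff F_lipschitz sigma_diff
  dsigma_bounded.
exists (C2 * C * CW + (C1 + C1 + C1)) => [|s u t s0 su ut tT].
  by rewrite !addr_ge0// !mulr_ge0.
have st := le_trans su ut; have u0 := le_trans s0 su; have uT := le_trans ut tT.
pose e a b := F (Z a + (W b - W a)) - F (Z a).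
set h := (t - s) `^ alpha.
have h0 : 0 <= h by exact: powR_ge0.
have mono a b : s <= a -> a <= b -> b <= t -> (b - a) `^ alpha <= h.
  move=> sa ab bt; apply: ge0_ler_powR; rewrite ?nnegrE ?subr_ge0 ?(ltW alpha0)//.
  exact: lerB.
have He : `|e s t - e s u - e u t| <= C2 * C * CW * h ^+ 3.
  have -> : e s t - e s u - e u t =
     (F (Z s + (W u - W s) + (W t - W u)) - F (Z s + (W u - W s)))
     - (F (Z u + (W t - W u)) - F (Z u)).
    rewrite /e -[Z s + (W u - W s) + (W t - W u)]addrA [W u - W s + _]addrC subrKA.
    by rewrite !opprB; move: (F _) (F _) (F _) (F _) (F _) => a1 a2 a3 a4 a5;
      apply/matrixP => i j; rewrite !mxE; ring.
  rewrite (le_trans (H2 _ _ _))//.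
  have -> : C2 * C * CW * h ^+ 3 = C2 * (C * h ^+ 2) * (CW * h) by ring.
  apply: ler_pM; rewrite ?mulr_ge0//.
    rewrite ler_wpM2l//.
    have -> : Z s + (W u - W s) - Z u = - (Z u - Z s - (W u - W s)).
      by apply/matrixP => i j; rewrite !mxE; ring.
    rewrite normrN (le_trans (ZW _ _ s0 su uT))// ler_wpM2l// powR_natM.
    by rewrite lerXn2r ?nnegrE ?powR_ge0// mono.
  by rewrite (le_trans (W_holder u0 ut tT))// ler_wpM2l// mono.
have Hg a b : s <= a -> a <= b -> b <= t -> `|e a b - germ a b| <= C1 * h ^+ 3.
  move=> sa ab bt.
  rewrite (le_trans (H1 _ _ (le_trans s0 sa) ab (le_trans bt tT)))// ler_wpM2l//.
  by rewrite powR_natM lerXn2r ?nnegrE ?powR_ge0// mono.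
have G1 := Hg _ _ (lexx s) st (lexx t).
have G2 := Hg _ _ (lexx s) su ut.
have G3 := Hg _ _ su ut (lexx t).
rewrite powR_natM -/h.
have -> : germ s t - germ s u - germ u t = (e s t - e s u - e u t)
   - (e s t - germ s t) + (e s u - germ s u) + (e u t - germ u t).
  move: (germ s t) (germ s u) (germ u t) (e s t) (e s u) (e u t) => *.
  by apply/matrixP => i j; rewrite !mxE; ring.
have -> : (C2 * C * CW + (C1 + C1 + C1)) * h ^+ 3 =
  C2 * C * CW * h ^+ 3 + C1 * h ^+ 3 + C1 * h ^+ 3 + C1 * h ^+ 3 by ring.
apply: le_trans (ler_normD _ _) _; apply: lerD; last exact: G3.
apply: le_trans (ler_normD _ _) _; apply: lerD; last exact: G2.
apply: le_trans (ler_normB _ _) _; apply: lerD; [exact: He|exact: G1].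
Qed.

Lemma germ_limit_additive (G : 'cV[R]_d -> 'cV[R]_d) (LG C : R) (x0 : 'cV[R]_d)
    (I : R -> 'cV[R]_d) :
  0 <= LG -> cancel F G -> (forall x y, `|G x - G y| <= LG * `|x - y|) ->
  0 <= C -> (forall s t, 0 <= s -> s <= t -> t <= T ->
    `|F (Z t) - F (Z s) - sigma (F (Z s)) *m (W t - W s)|
      <= C * (t - s) `^ (2 * alpha)) ->
  (forall t, 0 <= t -> t <= T ->
    partition_sum 0 t germ @ vanishing_mesh 0 t --> I t) ->
  (forall t, 0 <= t -> t <= T ->
    F (Z t) = x0 + vec_integral 0 t (fun r => f (F (Z r))) + I t) ->
  forall t, 0 <= t -> t <= T -> Z t - W t - drift t = Z 0 - W 0.
Proof.
move=> LG0 FK GL C0 XW IX XE.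
have [C1 C10 FT] := flow_taylor1 M0 L0 F_diff F_lipschitz sigma_diff
  dsigma_bounded.
(* F(Z_t) and F(Z_s + W_{s,t}) share the first-order expansion at Z_s, and the Lipschitz map G
   brings the comparison back to Z. *)
have ZW s t : 0 <= s -> s <= t -> t <= T ->
    `|Z t - Z s - (W t - W s)|
      <= LG * (C + C1 * CW ^+ 2) * (t - s) `^ (2 * alpha).
  move=> s0 st tT.
  have -> : Z t - Z s - (W t - W s) = G (F (Z t)) - G (F (Z s + (W t - W s))).
    by rewrite !FK -addrA -opprD.
  rewrite (le_trans (GL _ _))// -mulrA ler_wpM2l//.
  have -> : F (Z t) - F (Z s + (W t - W s)) =
      (F (Z t) - F (Z s) - sigma (F (Z s)) *m (W t - W s))
      - (F (Z s + (W t - W s)) - F (Z s) - sigma (F (Z s)) *m (W t - W s)).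
    move: (_ *m _) => q; by apply/matrixP => i j; rewrite !mxE; ring.
  rewrite mulrDl; apply: le_trans (ler_normB _ _) _; apply: lerD; first exact: XW.
  rewrite (le_trans (FT _ _))// -mulrA ler_wpM2l// powR_natM -exprMn.
  by rewrite lerXn2r ?nnegrE ?mulr_ge0 ?powR_ge0// W_holder.
have D0 : 0 <= LG * (C + C1 * CW ^+ 2).
  by rewrite mulr_ge0// addr_ge0// mulr_ge0// exprn_ge0.
have [C2 C20 HC2] := germ_almost_additive D0 ZW.
have [K HK] := partition_limit_sewing alpha13 C20 HC2 IX.
have [C3 C30 HC3] := local_expansion.
move=> t t0 tT; apply/eqP; rewrite -subr_eq0; apply/eqP.
pose D t := Z t - W t - drift t.
have -> : Z 0 - W 0 = D 0 by rewrite /D /drift vec_integralxx subr0.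
rewrite -/(D t).
(* The increments of [D] are of order 3 alpha > 1, so sums of the zero germ converge to D t - D 0;
   they also converge to 0. *)
have cD : partition_sum 0 t (fun _ _ => 0) @ vanishing_mesh 0 t --> D t - D 0.
  apply: (@cvg_partition_sum _ _ _ _ _ _ (LG * (K + C3)) _ t0 alpha13).
  move=> u v u0 /ltW uv vt; have vT := le_trans vt tT.
  set p := F (Z u + (W v - W u) + (drift v - drift u)).
  have -> : D v - D u - 0 = G (F (Z v)) - G p.
    by rewrite !FK /D; apply/matrixP => i j; rewrite !mxE; ring.
  rewrite (le_trans (GL _ _))// -mulrA ler_wpM2l//.
  have -> : F (Z v) - p = (I v - I u - germ u v)
      - (p - F (Z u) - vec_integral u v (fun r => f (F (Z r))) - germ u v).
    rewrite (XE v (le_trans u0 uv) vT) (XE u u0 (le_trans uv vT)).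
    rewrite (vec_integral_itvS u0 uv); last exact: FZ_integrable.
    move: (germ u v) (vec_integral 0 u _) (vec_integral u v _) => e J1 J2.
    by apply/matrixP => i j; rewrite !mxE; ring.
  apply: le_trans (ler_normB _ _) _; rewrite mulrDl; apply: lerD.
    exact: HK.
  exact: HC3.
have c0 : partition_sum 0 t (fun _ _ => 0 : 'cV[R]_d) @ vanishing_mesh 0 t -->
    (0 : 'cV[R]_d).
  rewrite (_ : partition_sum _ _ _ = (fun=> 0 : 'cV[R]_d)); first exact: cvg_cst.
  by apply/funext => s; rewrite /partition_sum big1.
have FF := vanishing_mesh_proper t0.
rewrite -(cvg_lim (@norm_hausdorff _ _) cD); exact: (cvg_lim (@norm_hausdorff _ _) c0).
Qed.

Lemma additive_germ_limit (z0 : 'cV[R]_d) :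
  (forall t, 0 <= t -> t <= T -> Z t = z0 + drift t + W t) ->
  forall t, 0 <= t -> t <= T ->
  partition_sum 0 t germ @ vanishing_mesh 0 t -->
    F (Z t) - F (Z 0) - vec_integral 0 t (fun r => f (F (Z r))).
Proof.
move=> ZE; have [C C0 HC] := local_expansion.
move=> t t0 tT; pose J t := F (Z t) - vec_integral 0 t (fun r => f (F (Z r))).
have -> : F (Z t) - F (Z 0) - vec_integral 0 t (fun r => f (F (Z r))) = J t - J 0.
  by rewrite /J vec_integralxx subr0 addrAC.
apply: (@cvg_partition_sum _ _ _ _ _ _ C _ t0 alpha13).
move=> u v u0 /ltW uv vt; have vT := le_trans vt tT.
have := HC u v u0 uv vT.
have -> : Z u + (W v - W u) + (drift v - drift u) = Z v.
  rewrite (ZE v (le_trans u0 uv) vT) (ZE u u0 (le_trans uv vT)).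
  by apply/matrixP => i j; rewrite !mxE; ring.
have -> // : F (Z v) - F (Z u) - vec_integral u v (fun r => f (F (Z r))) = J v - J u.
rewrite /J (vec_integral_itvS u0 uv); last exact: FZ_integrable.
move: (vec_integral 0 u _) (vec_integral u v _) => J1 J2.
by apply/matrixP => i j; rewrite !mxE; ring.
Qed.

(** The drift is Lipschitz, so Z inherits the exponent of W, and exchanging W_{s,t} for Z_{s,t} in
    the linear term costs O(h^2). Absolute values appear because [controlled] also constrains pairs
    with s > t. *)
Lemma additive_controlled (z0 : 'cV[R]_d) (CW' : R) : 0 <= CW' ->
  (forall s t, 0 <= s <= T -> 0 <= t <= T ->
    `|W t - W s| <= CW' * `|t - s| `^ alpha) ->
  (forall t, 0 <= t -> t <= T -> Z t = z0 + drift t + W t) ->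
  exists2 C, 0 <= C & forall s t, 0 <= s <= T -> 0 <= t <= T ->
    `|Z t - Z s| <= C * `|t - s| `^ alpha /\
    `|F (Z t) - F (Z s) - sigma (F (Z s)) *m (W t - W s)|
      <= C * `|t - s| `^ (2 * alpha).
Proof.
move=> CW'0 W_h ZE.
have [C1 C10 FT] := flow_taylor1 M0 L0 F_diff F_lipschitz sigma_diff
  dsigma_bounded.
have [c c0 cP] := ler_sqr_powR T alpha0 alpha12.
have drift_abs s t : 0 <= s <= T -> 0 <= t <= T ->
    `|drift t - drift s| <= Mg * `|t - s|.
  move=> /andP[s0 sT] /andP[t0 tT]; have [st|/ltW ts] := leP s t.
    by rewrite ger0_norm ?subr_ge0// drift_lipschitz.
  by rewrite distrC [`|t - s|]distrC ger0_norm ?subr_ge0// drift_lipschitz.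
pose CZ' := CW' + Mg * c * T `^ alpha.
have CZ'0 : 0 <= CZ' by rewrite addr_ge0// !mulr_ge0// powR_ge0.
have Q0 : 0 <= C1 * CZ' ^+ 2 + d%:R * M * (Mg * c).
  by rewrite addr_ge0// mulr_ge0// ?exprn_ge0// mulr_ge0.
exists (CZ' + (C1 * CZ' ^+ 2 + d%:R * M * (Mg * c))) => [|s t sT tT].
  exact: addr_ge0.
set h := `|t - s| `^ alpha; have h0 : 0 <= h by exact: powR_ge0.
have tsT : `|t - s| <= T.
  by move: sT tT => /andP[? ?] /andP[? ?]; rewrite ler_norml; lra.
have hT : h <= T `^ alpha.
  by apply: ge0_ler_powR; rewrite ?nnegrE ?(ltW alpha0)// (le_trans _ tsT).
have rh : `|drift t - drift s| <= Mg * c * h ^+ 2.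
  rewrite (le_trans (drift_abs _ _ sT tT))// -mulrA ler_wpM2l//.
  by rewrite cP// normr_ge0.
have Zinc : Z t - Z s = (W t - W s) + (drift t - drift s).
  move: sT tT => /andP[s0 sT] /andP[t0 tT]; rewrite (ZE t t0 tT) (ZE s s0 sT).
  by apply/matrixP => i j; rewrite !mxE; ring.
have Zh : `|Z t - Z s| <= CZ' * h.
  rewrite Zinc /CZ' mulrDl; apply: le_trans (ler_normD _ _) _.
  apply: lerD; first exact: W_h.
  by rewrite (le_trans rh)// expr2 mulrA ler_wpM2r// ler_wpM2l// mulr_ge0.
split.
  by rewrite (le_trans Zh)// ler_wpM2r// lerDl.
have -> : F (Z t) - F (Z s) - sigma (F (Z s)) *m (W t - W s) =
    (F (Z s + (Z t - Z s)) - F (Z s) - sigma (F (Z s)) *m (Z t - Z s))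
    + sigma (F (Z s)) *m (drift t - drift s).
  by rewrite subrKC Zinc [_ *m (_ + (drift t - _))]mulmxDr opprD addrA subrK.
rewrite powR_natM -/h mulrDl ler_wpDl ?mulr_ge0 ?exprn_ge0// mulrDl.
apply: le_trans (ler_normD _ _) _; apply: lerD.
  rewrite (le_trans (FT _ _))// -mulrA ler_wpM2l// -exprMn.
  rewrite lerXn2r ?nnegrE//.
  exact: le_trans Zh.
have -> : d%:R * M * (Mg * c) * h ^+ 2 = d%:R * M * (Mg * c * h ^+ 2) by ring.
rewrite (le_trans (ler_norm_mulmx _ _))//; apply: ler_pM => //.
  by rewrite ler_wpM2l.
Qed.

End transformed_equation.

(** * The two implications for a fixed geometric rough path *)

Section rde_transform.
Context {R : realType} {d : nat}.
Variables (F G : 'cV[R]_d -> 'cV[R]_d) (sigma : 'cV[R]_d -> 'M[R]_d) (M L LG : R).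
Hypothesis M0 : 0 <= M.
Hypothesis L0 : 0 <= L.
Hypothesis LG0 : 0 <= LG.
Hypothesis FK : cancel F G.
Hypothesis G_lipschitz : forall x y, `|G x - G y| <= LG * `|x - y|.
Hypothesis F_diff : forall z, is_diff z F (mulmx (sigma (F z))).
Hypothesis F_lipschitz : forall x y, `|F x - F y| <= L * `|x - y|.
Hypothesis sigma_diff : forall x, differentiable sigma x.
Hypothesis sigma_bounded : forall x, `|sigma x| <= M.
Hypothesis dsigma_bounded : forall x v, `|'d sigma x v| <= M * `|v|.
Hypothesis dsigma_lipschitz : forall x y v,
  `|'d sigma x v - 'd sigma y v| <= M * `|x - y| * `|v|.
Variables (f g : 'cV[R]_d -> 'cV[R]_d) (Mg : R).
Hypothesis f_continuous : continuous f.
Hypothesis g_continuous : continuous g.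
Hypothesis g_bounded : forall z, `|g z| <= Mg.
Hypothesis sigma_g : forall z, sigma (F z) *m g z = f (F z).
Variables (T alpha : R) (W : R -> 'cV[R]_d) (WW : R -> R -> 'M[R]_d).
Hypothesis T0 : 0 < T.
Hypothesis alpha0 : 0 < alpha.
Hypothesis alpha12 : 2 * alpha <= 1.
Hypothesis alpha13 : 1 < 3 * alpha.
Hypothesis W0 : W 0 = 0.
Hypothesis W_geometric : is_geometric_rough_path T alpha W WW.

Let Dsigma x : {linear 'cV[R]_d -> 'M[R]_d} := 'd sigma x.

Let sigma_is_diff x : is_diff x sigma (Dsigma x).
Proof. exact: differentiableP. Qed.

Let W_holder_abs : exists2 C, 0 <= C & forall s t,
  0 <= s <= T -> 0 <= t <= T -> `|W t - W s| <= C * `|t - s| `^ alpha.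
Proof.
have [[_ WH _] _] := W_geometric; move/holder_boundP : WH; apply.
  by rewrite gt_eqF.
by move=> s; rewrite /increment subrr.
Qed.

Lemma rough_germ (Z : R -> 'cV[R]_d) s t : 0 <= s -> s <= t -> t <= T ->
  sigma (F (Z s)) *m increment W s t
    + rough_contract (fun a => 'd sigma (F (Z s)) (col a (sigma (F (Z s)))))
        (WW s t)
  = germ F sigma Dsigma W Z s t.
Proof.
move=> s0 st tT; rewrite /germ; congr (_ + _).
have [_ /(_ s t)] := W_geometric; rewrite s0 (le_trans s0 st) (le_trans st tT) tT.
move=> /(_ isT isT) sym.
exact: (rough_contract_geometric M0 L0 F_diff F_lipschitz sigma_is_diff
  sigma_bounded dsigma_bounded dsigma_lipschitz (Z s) sym).
Qed.

Lemma rde_additive (Z : R -> 'cV[R]_d) (x0 : 'cV[R]_d) :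
  is_rde_solution T alpha W WW f sigma x0 (fun t => F (Z t))
    (fun t => sigma (F (Z t))) ->
  {within `[0, T], continuous Z} /\
  forall t, 0 <= t <= T ->
    Z t = G x0 + vec_integral 0 t (fun r => g (Z r)) + W t.
Proof.
move=> [[Xc _ XH _ RH] XE].
have [CW CW0 WH] := W_holder_abs.
have ZE : Z = (fun t => G (F (Z t))) by apply/funext => t; rewrite FK.
have Zc : {within `[0, T], continuous Z}.
  rewrite ZE => t.
  apply: (@continuous_comp _ _ _ ((fun t => F (Z t)) : subspace `[0, T] -> _) G).
    exact: Xc.
  exact: (lipschitz_continuous G_lipschitz).
split => //.
have alphaN0 : alpha != 0 by rewrite gt_eqF.
have alpha2N0 : 2 * alpha != 0 by rewrite mulf_eq0 pnatr_eq0/=.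
move: XH => /(@holder_boundP _ _ _ _ _ alphaN0) [|CX CX0 XH].
  by move=> s; rewrite /increment subrr.
move: RH => /(@holder_boundP _ _ _ _ _ alpha2N0) [|CR CR0 RH].
  by move=> s; rewrite /increment !subrr mulmx0 subrr.
have inT s t : 0 <= s -> s <= t -> t <= T ->
    [/\ 0 <= s <= T, 0 <= t <= T & `|t - s| = t - s].
  move=> s0 st tT; rewrite s0 (le_trans st tT) (le_trans s0 st) tT.
  by rewrite ger0_norm// subr_ge0.
have W_h s t : 0 <= s -> s <= t -> t <= T -> `|W t - W s| <= CW * (t - s) `^ alpha.
  by move=> s0 st tT; have [sT tT' <-] := inT _ _ s0 st tT; exact: WH.
have Z_h s t : 0 <= s -> s <= t -> t <= T ->
    `|Z t - Z s| <= LG * CX * (t - s) `^ alpha.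
  move=> s0 st tT; have [sT tT' <-] := inT _ _ s0 st tT.
  rewrite -(FK (Z t)) -(FK (Z s)) (le_trans (G_lipschitz _ _))// -mulrA.
  by rewrite ler_wpM2l//; exact: XH.
have R_h s t : 0 <= s -> s <= t -> t <= T ->
    `|F (Z t) - F (Z s) - sigma (F (Z s)) *m (W t - W s)|
      <= CR * (t - s) `^ (2 * alpha).
  by move=> s0 st tT; have [sT tT' <-] := inT _ _ s0 st tT; exact: RH.
(* A solution provides an integral for each time separately; choice collects them into a path, with
   the default 0 outside [0, T]. *)
have /choice[I IP] : forall t, exists I, 0 <= t <= T ->
    partition_sum 0 t (germ F sigma Dsigma W Z) @ vanishing_mesh 0 t --> I /\
    F (Z t) = x0 + vec_integral 0 t (fun r => f (F (Z r))) + I.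
  move=> t; have [tT|tT] := boolP (0 <= t <= T); last by exists 0.
  have [_ [I HI E]] := XE t tT; exists I => _; split => //.
  have /andP[t0 tT'] := tT.
  apply: eq_cvg_partition_sum HI => u v u0 uv vt.
  exact: (rough_germ Z u0 uv (le_trans vt tT')).
have I_lim t : 0 <= t -> t <= T ->
    partition_sum 0 t (germ F sigma Dsigma W Z) @ vanishing_mesh 0 t --> I t.
  by move=> t0 tT; have [] := IP t; rewrite ?t0.
have I_eq t : 0 <= t -> t <= T ->
    F (Z t) = x0 + vec_integral 0 t (fun r => f (F (Z r))) + I t.
  by move=> t0 tT; have [] := IP t; rewrite ?t0.
have CZ0 : 0 <= LG * CX by exact: mulr_ge0.
have main := germ_limit_additive M0 L0 F_diff F_lipschitz sigma_is_diff
  dsigma_bounded dsigma_lipschitz f_continuous g_continuous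
  g_bounded sigma_g alpha0 alpha12 alpha13 CW0 CZ0 W_h Z_h Zc LG0 FK G_lipschitz
  CR0 R_h I_lim I_eq.
(* The only partition of [0, 0] is empty. This yields the initial condition. *)
have I0 : I 0 = 0.
  have FF := vanishing_mesh_proper (lexx (0 : R)).
  rewrite -(cvg_lim (@norm_hausdorff _ _) (I_lim 0 (lexx _) (ltW T0))).
  apply: (cvg_lim (@norm_hausdorff _ _)).
  apply/cvgrPdist_le => e e0; apply: (vanishing_mesh_near ltr01) => s.
  by move=> /itv_partitionxx -> _; rewrite partition_sum_nil subrr normr0 ltW.
have Z0 : Z 0 = G x0.
  rewrite -(FK (Z 0)) (I_eq 0 (lexx _) (ltW T0)) I0 vec_integralxx.
  by rewrite !addr0.
move=> t /andP[t0 tT]; have := main t t0 tT; rewrite W0 subr0 Z0 => <-.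
rewrite /drift; move: (vec_integral _ _ _) => J.
by apply/matrixP => i j; rewrite !mxE; ring.
Qed.

Lemma additive_rde (Z : R -> 'cV[R]_d) (x0 : 'cV[R]_d) :
  cancel G F ->
  {within `[0, T], continuous Z} ->
  (forall t, 0 <= t <= T ->
    Z t = G x0 + vec_integral 0 t (fun r => g (Z r)) + W t) ->
  is_rde_solution T alpha W WW f sigma x0 (fun t => F (Z t))
    (fun t => sigma (F (Z t))).
Proof.
move=> GK Zc ZE.
have [CW CW0 WH] := W_holder_abs.
have ZE' t : 0 <= t -> t <= T -> Z t = G x0 + drift g Z t + W t.
  by move=> t0 tT; apply: ZE; rewrite t0.
have [C C0 HC] := additive_controlled M0 L0 F_diff F_lipschitz sigma_is_diff
  sigma_bounded dsigma_bounded g_continuous g_bounded alpha0 alpha12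
  Zc CW0 WH ZE'.
have alphaN0 : alpha != 0 by rewrite gt_eqF.
have alpha2N0 : 2 * alpha != 0 by rewrite mulf_eq0 pnatr_eq0/=.
have Fc : continuous F := lipschitz_continuous F_lipschitz.
have sc : continuous sigma.
  by move=> x; exact: differentiable_continuous.
have Xc : {within `[0, T], continuous (fun t => F (Z t))}.
  move=> t; apply: (@continuous_comp _ _ _ (Z : subspace `[0, T] -> _) F).
    exact: Zc.
  exact: Fc.
have sl x y : `|sigma x - sigma y| <= M * `|x - y|.
  exact: (sigma_lip sigma_is_diff dsigma_bounded).
have XH s t : 0 <= s <= T -> 0 <= t <= T ->
    `|F (Z t) - F (Z s)| <= L * C * `|t - s| `^ alpha.
  move=> sT tT; rewrite (le_trans (F_lipschitz _ _))// -mulrA ler_wpM2l//.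
  by have [] := HC s t sT tT.
split.
  split => //.
  - move=> t; apply: (@continuous_comp _ _ _
      ((fun t => F (Z t)) : subspace `[0, T] -> _) sigma); first exact: Xc.
    exact: sc.
  - apply/(@holder_boundP _ _ _ _ _ alphaN0).
      by move=> s; rewrite /increment subrr.
    by exists (L * C); [exact: mulr_ge0|exact: XH].
  - apply/(@holder_boundP _ _ _ _ _ alphaN0).
      by move=> s; rewrite /increment subrr.
    exists (M * (L * C)) => [|s t sT tT]; first by rewrite !mulr_ge0.
    rewrite (le_trans (sl _ _))// -mulrA ler_wpM2l//.
    exact: XH.
  - apply/(@holder_boundP _ _ _ _ _ alpha2N0).
      by move=> s; rewrite /increment !subrr mulmx0 subrr.
    exists C => // s t sT tT; by have [] := HC s t sT tT.
move=> t tT; split => //; have /andP[t0 tT'] := tT.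
have inT s r : 0 <= s -> s <= r -> r <= T ->
    [/\ 0 <= s <= T, 0 <= r <= T & `|r - s| = r - s].
  move=> s0 st rT; rewrite s0 (le_trans st rT) (le_trans s0 st) rT.
  by rewrite ger0_norm// subr_ge0.
have W_h s r : 0 <= s -> s <= r -> r <= T -> `|W r - W s| <= CW * (r - s) `^ alpha.
  by move=> s0 st rT; have [sT rT' <-] := inT _ _ s0 st rT; exact: WH.
have Z_h s r : 0 <= s -> s <= r -> r <= T -> `|Z r - Z s| <= C * (r - s) `^ alpha.
  move=> s0 st rT; have [sT rT' <-] := inT _ _ s0 st rT.
  by have [] := HC s r sT rT'.
have lim := additive_germ_limit M0 L0 F_diff F_lipschitz sigma_is_diff
  dsigma_bounded dsigma_lipschitz f_continuous g_continuous
  g_bounded sigma_g alpha0 alpha12 alpha13 CW0 C0 W_h Z_h Zc ZE' t0 tT'.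
(* This candidate makes the integral equation hold by construction once F (Z 0) = x0; what needs
   proof is that the Riemann sums converge to it. *)
exists (F (Z t) - F (Z 0) - vec_integral 0 t (fun r => f (F (Z r)))).
  apply: eq_cvg_partition_sum lim => u v u0 uv vt.
  by apply/esym; exact: (rough_germ Z u0 uv (le_trans vt tT')).
have -> : F (Z 0) = x0.
  by rewrite (ZE' 0 (lexx _) (ltW T0)) W0 /drift vec_integralxx !addr0 GK.
move: (vec_integral _ _ _) => J.
by apply/matrixP => i j; rewrite !mxE; ring.
Qed.

End rde_transform.

(** * Assembly: G, its inverse, and the equivalence path by path *)

Theorem proposition2p1 (R : realType) (d : nat) (T H alpha : R)
    (x0 : 'cV[R]_d)
    (disp : measure_display) (Omega : measurableType disp)
    (P : probability Omega R)
    (B : R -> 'I_d -> {RV P >-> R})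
    (BB : R -> R -> 'I_d -> 'I_d -> {RV P >-> R})
    (Omega' : set Omega)
    (f : 'cV[R]_d -> 'cV[R]_d) (sigma : 'cV[R]_d -> 'M[R]_d)
    (hd : (1 <= d)%N) (hT : 0 < T)
    (hH : 3^-1 < H <= 2^-1) (halpha : 3^-1 < alpha < H)
    (hB : is_fbm T H B)
    (hBB : H = 2^-1 -> is_stratonovich_lift T B BB)
    (hOmega'm : measurable Omega') (hOmega'P : P Omega' = 1%E)
    (hB0 : forall w, Omega' w -> sample_path B w 0 = 0)
    (hlift : forall w, Omega' w ->
       is_geometric_rough_path T alpha (sample_path B w) (sample_lift BB w))
    (hF1 : bounded_fun f /\ continuous f)
    (hS1 : C2_bounded sigma)
    (hS2 : exists2 lambda : R, 0 < lambda & forall v x : 'cV[R]_d,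
       lambda * \sum_i v i 0 ^+ 2 <= `|(v^T *m sigma x *m v) 0 0|)
    (hS3 : conservative (fun x => invmx (sigma x))) :
  exists (G Ginv : 'cV[R]_d -> 'cV[R]_d),
    diffeomorphism G Ginv /\
    (forall z, is_diff z G (mulmx (invmx (sigma z)))) /\
    let ftilde := fun z : 'cV[R]_d => 'd G (Ginv z) (f (Ginv z)) in
    bounded_fun ftilde /\ continuous ftilde /\
    (forall w, Omega' w -> forall X : R -> 'cV[R]_d,
       is_rde_solution T alpha (sample_path B w) (sample_lift BB w) f sigma x0
         X (fun t => sigma (X t)) <->
       is_additive_solution T (sample_path B w) ftilde (G x0)
         (fun t => G (X t))).
Proof.
have [fb fc] := hF1; have [[sd sC2] [M sM]] := hS1.
have [lambda lambda0 ell] := hS2.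
have sigma_bounded x : `|sigma x| <= M by have [] := sM x.
have dsigma_bounded x v : `|'d sigma x v| <= M * `|v| by have [_ + _] := sM x; exact.
have M0 : 0 <= M by rewrite (le_trans _ (sigma_bounded 0)).
(* The bound on D^2 sigma enters only in this integrated form. *)
have dsigma_lipschitz x y v :
    `|'d sigma x v - 'd sigma y v| <= M * `|x - y| * `|v|.
  rewrite mulrAC; have [sdv _] := sC2 v.
  apply: (diff_bounded_lipschitz (fun z => differentiableP (sdv z))) => z w.
  by have [_ _] := sM z; exact.
have sigma_lipschitz := diff_bounded_lipschitz
  (fun z => differentiableP (sd z)) dsigma_bounded.
have mulSA := mul_sigma_invsigma lambda0 ell; have mulAS := mul_invsigma_sigma lambda0 ell.
have A_bounded := norm_invsigma lambda0 ell.
have [LA LA0 A_lipschitz] :=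
  invsigma_lipschitz lambda0 ell sigma_bounded sigma_lipschitz.
have [mu mu0 A_form] := invsigma_form lambda0 ell sigma_bounded.
pose G := potential (fun x => invmx (sigma x)).
have G_diff : forall z, is_diff z G (mulmx (invmx (sigma z))).
  exact: is_diff_potential LA0 A_lipschitz hS3.
have G_quadratic : forall z w,
    `|G (z + w) - G z - invmx (sigma z) *m w| <= d%:R * LA * `|w| ^+ 2.
  exact: potential_quadratic LA0 A_lipschitz hS3.
have dLA0 : 0 <= d%:R * LA by exact: mulr_ge0.
have [F [GK FK [L L0 F_lipschitz] F_diff]] := global_inverse mu0 A_form mulSA
  mulAS sigma_bounded G_diff dLA0 G_quadratic.
have a0 : 0 <= d%:R / lambda by rewrite divr_ge0// ltW.
have G_lipschitz x y : `|G x - G y| <= d%:R * (d%:R / lambda) * `|x - y|.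
  apply: (diff_bounded_lipschitz G_diff) => z v.
  by rewrite (le_trans (ler_norm_mulmx _ _))// ler_wpM2r// ler_wpM2l.
have Fc : continuous F := lipschitz_continuous F_lipschitz.
have Ac : continuous (fun x => invmx (sigma x)) := lipschitz_continuous A_lipschitz.
have sc : continuous sigma := lipschitz_continuous sigma_lipschitz.
have sFc : continuous (fun z => sigma (F z)).
  by move=> z; apply: continuous_comp; [exact: Fc|exact: sc].
have AFc : continuous (fun z => invmx (sigma (F z))).
  move=> z; apply: (@continuous_comp _ _ _ F (fun x => invmx (sigma x))).
    exact: Fc.
  exact: Ac.
have fFc : continuous (fun z => f (F z)).
  by move=> z; apply: continuous_comp; [exact: Fc|exact: fc].
exists G, F; split; last split => //.
  split => //.
    split=> [x|v]; first exact: ex_diff.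
    rewrite (_ : (fun x => 'd G x v) = (fun x => invmx (sigma x) *m v)).
      by apply: (@continuous_mulmx _ _ _ _ _ _ (cst v) Ac); exact: cst_continuous.
    by apply/funext => z; rewrite (@diff_val _ _ _ _ _ _ _ (G_diff z)).
  split=> [x|v]; first exact: ex_diff.
  rewrite (_ : (fun x => 'd F x v) = (fun x => sigma (F x) *m v)).
    by apply: (@continuous_mulmx _ _ _ _ _ _ (cst v) sFc); exact: cst_continuous.
  by apply/funext => z; rewrite (@diff_val _ _ _ _ _ _ _ (F_diff z)).
move=> ftilde; have ftildeE : ftilde = fun z => invmx (sigma (F z)) *m f (F z).
  by apply/funext => z; rewrite /ftilde (@diff_val _ _ _ _ _ _ _ (G_diff _)).
clearbody ftilde.
(* [bounded_fun] gives a bound by every number above some [N], hence [N + 1]. *)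
have [Mf fMf] : exists Mf, forall z, `|f z| <= Mf.
  case: fb => N [_ /(_ (N + 1))]; rewrite ltrDl ltr01 => /(_ isT) fN.
  by exists (N + 1) => z; exact: fN.
have Mf0 : 0 <= Mf by rewrite (le_trans _ (fMf 0)).
have ftilde_bounded z : `|ftilde z| <= d%:R * (d%:R / lambda) * Mf.
  rewrite ftildeE (le_trans (ler_norm_mulmx _ _))//.
  apply: ler_pM; rewrite ?mulr_ge0//.
  by rewrite ler_wpM2l.
have ftilde_continuous : continuous ftilde.
  by rewrite ftildeE; exact: (continuous_mulmx AFc fFc).
split; first by exists (d%:R * (d%:R / lambda) * Mf); split; [exact: num_real|
  move=> y my z _; exact: le_trans (ltW my)].
split=> // w Ow X.
have sigma_ftilde z : sigma (F z) *m ftilde z = f (F z).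
  by rewrite ftildeE; exact: mulSA.
have alpha0 : 0 < alpha by move: halpha; lra.
have alpha12 : 2 * alpha <= 1 by move: hH halpha; lra.
have alpha13 : 1 < 3 * alpha by move: halpha; lra.
have dda0 : 0 <= d%:R * (d%:R / lambda) by exact: mulr_ge0.
set Z := fun t => G (X t).
(* As G is a bijection, every path X has this form, and both implications can be stated for F(Z). *)
have XE : X = (fun t => F (Z t)) by apply/funext => t; rewrite /Z GK.
clearbody Z; subst X; split => [sol|[Zc ZE]].
- exact: (rde_additive M0 L0 dda0 FK G_lipschitz F_diff F_lipschitz sd
    sigma_bounded dsigma_bounded dsigma_lipschitz fc ftilde_continuous
    ftilde_bounded sigma_ftilde hT alpha0 alpha12 alpha13 (hB0 w Ow) (hlift w Ow)
    sol).
- exact: (additive_rde M0 L0 F_diff F_lipschitz sd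
    sigma_bounded dsigma_bounded dsigma_lipschitz fc ftilde_continuous
    ftilde_bounded sigma_ftilde hT alpha0 alpha12 alpha13 (hB0 w Ow) (hlift w Ow)
    GK Zc ZE).
Qed.
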